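(* Suppose $W$ is a 4-manifold and $\tilde h_W:\Sigma\times S^1\to\partial W$ is a diffeomorphism. Suppose further that $$[\tilde h_W(b_1,1),\tilde h_W(a_2,1)]=1\quad\text{in }\pi_1(W).$$ Denote by $Z_W$ the closed 4-manifold $$Z_W=W\cup_{\tilde h_P\circ(\Psi\times-\mathrm{Id})\circ\tilde h_W^{-1}}\big(P\setminus\mathrm{Nbd}(\Sigma_{P,\delta})\big).$$ Then $$[\tilde h_W(a_1,1),\tilde h_W(a_2,1)]=1=[y'\bar x'\bar y',\,y''\bar x''\bar y'']\quad\text{in }\pi_1(Z_W).$$
   Context: Conventions. $S^1=\mathbb R/2\pi\mathbb Z$ (also regarded as the unit circle $\partial D^2\subset\mathbb C$), $\mathbb T^n=(S^1)^n$; $\mathbb T^4$ has coordinates $(x,y,z,t)$. $\bar g=g^{-1}$, $[a,b]=ab\bar a\bar b$; paths are composed left to right. Fix $0<\epsilon\le\pi/30$. $\mathrm{Nbd}$ denotes an (open) tubular neighborhood. $(\Sigma,\sigma)$ is a closed oriented genus two surface with $\pi_1(\Sigma,\sigma)=\langle a_1,b_1,a_2,b_2\mid[a_1,b_1][a_2,b_2]\rangle$ in the usual octagon presentation, $a_1\cdot b_1=1$; $D^2\subset\mathbb C$ is the unit disk. $\tilde h_W(a_i,1)$ denotes the image of the loop $a_i\times\{1\}$, based at $\tilde h_W(\sigma,1)$. $-\mathrm{Id}$ on $S^1$ is $e^{i\theta}\mapsto e^{-i\theta}$. Tori and loops. $T_x=\{(x,-\frac\pi2,\frac\pi2,t)\}$,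 $T_y=\{(\frac\pi2,y,-\frac\pi2,t)\}$, $T_z=\{(-\frac\pi2,\frac\pi2,z,t)\}$ are disjoint 2-tori in $\mathbb T^4$ with $\epsilon$-neighborhoods $\mathrm{Nbd}(T_x)$, etc. $e=(0,0,0,0)$; the loops $x,y,z,t$ based at $e$ are the coordinate circles through $e$. $\mu_x$ is the meridian of $T_x$ based by the straight segment (in $[-\pi,\pi]^4$) from $e$ towards $(0,-\frac\pi2,\frac\pi2,0)$, running once around the $\epsilon$-circle about this point in the $yz$-plane, counterclockwise for the orientation $(y,z)$; $\mu_y$ is defined likewise with $(\frac\pi2,0,-\frac\pi2,0)$ and orientation $(z,x)$. $\mathbb T^4_{\rm sur}$ is the closed 4-manifold obtained from $\mathbb T^4$ by removing $\mathrm{Nbd}(T_x)$ and $\mathrm{Nbd}(T_y)$ and gluing in two copies of $D^2\times\mathbb T^2$ so that $\partial(D^2\times\{pt\})$ is $x\bar\mu_x\in\pi_1(\partial\mathrm{Nbd}(T_x))\cong H_1=\mathbb Z\langle x,t,\mu_x\rangle$ for the first, and $t\bar\mu_y\in\pi_1(\partial\mathrm{Nbd}(T_y))\cong H_1=\mathbb Z\langle y,t,\mu_y\rangle$ for the second (coordinate circles are pushed to the boundary by translation). The manifold $P$. Let $\mathbb T^{4\prime}_{\rm sur},\mathbb T^{4\prime\prime}_{\rm sur}$ be two copies of $\mathbb T^4_{\rm sur}$; objects in them carry $'$ and $''$. Parametrize $\partial\mathrm{Nbd}(T_z)$ by $(z,t,\theta)\mapsto(-\frac\pi2,\frac\pi2,z,t)+\epsilon(\cos(\theta-\frac\pi4),\sin(\theta-\frac\pi4),0,0)$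 and let $\phi:\partial\mathrm{Nbd}(T_z')\to\partial\mathrm{Nbd}(T_z'')$ be $\phi(z,t,\theta)=(t,-z,-\theta)$. Set $P=(\mathbb T^{4\prime}_{\rm sur}\setminus\mathrm{Nbd}(T_z'))\cup_\phi(\mathbb T^{4\prime\prime}_{\rm sur}\setminus\mathrm{Nbd}(T_z''))$. Let $E_0=\{(x,y)\in\mathbb T^2:\mathrm{dist}((x,y),(-\frac\pi2,\frac\pi2))\ge\epsilon\}$, also viewed as $E_0\times\{(0,0)\}\subset\mathbb T^4$; let $e_z=(-\frac\pi2+\frac\epsilon{\sqrt2},\frac\pi2-\frac\epsilon{\sqrt2},0,0)$ and let $\rho_1$ be the line segment from $e$ to $e_z$. Then $\phi(e_z')=e_z''$ and $\Sigma_P=E_0'\cup_\phi E_0''$ is a closed oriented genus two surface. Loops based at $e',e''$ are regarded as based at $e_z'=e_z''$ by means of $\rho_1',\rho_1''$. For small $\delta\in(0,\epsilon^2/8)$ put $\Sigma_{P,\delta}=E_0'\times(\delta,\delta)\cup E_0''\times(\delta,-\delta)$, the push-off of $\Sigma_P$ along the vector field equal to $\partial_z+\partial_t$ on $E_0'$ and $\partial_z-\partial_t$ on $E_0''$. Let $\tilde h_P:\Sigma\times D^2\to P$ be an orientation preserving embedding with $\tilde h_P(\Sigma\times0)=\Sigma_{P,\delta}$, $\tilde h_P(\Sigma\times1)=\Sigma_P$, $\tilde h_P(\sigma,1)=e_z'$, and $\tilde h_P(\cdot,1)$ inducing $a_1\mapsto y'$, $b_1\mapsto\bar x'$, $a_2\mapsto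 y''$, $b_2\mapsto\bar x''$ into $\pi_1(\Sigma_P,e_z')$; $\mathrm{Nbd}(\Sigma_{P,\delta})$ is the interior of $\tilde h_P(\Sigma\times D^2)$. $\Psi:(\Sigma,\sigma)\to(\Sigma,\sigma)$ is a diffeomorphism inducing $a_1\mapsto a_1b_1\bar a_1$, $b_1\mapsto\bar a_1$, $a_2\mapsto a_2b_2\bar a_2$, $b_2\mapsto\bar a_2$ on $\pi_1(\Sigma,\sigma)$. In $Z_W$ the base points $\tilde h_W(\sigma,1)$ and $e_z'$ are identified. *)

(* Defs.v *)
From HB Require Import structures.
From Stdlib Require Import Relation_Operators.
From mathcomp Require Import all_boot all_order all_algebra.
From mathcomp Require Import all_classical all_reals all_analysis.

Set Implicit Arguments.
Unset Strict Implicit.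
Unset Printing Implicit Defensive.

Import Order.TTheory GRing.Theory Num.Theory.
Import numFieldNormedType.Exports.
Local Open Scope classical_set_scope.
Local Open Scope ring_scope.

(* Smooth manifolds are topological spaces with an atlas of local
   parametrizations (inverse charts).  Maps between them are total functions
   considered on a subset of the source, and smoothness on a subset means that
   in local coordinates the map extends smoothly to open sets.  This treats
   open manifolds, manifolds with boundary and codimension zero pieces of a
   manifold uniformly. *)
Section Smooth.
Context {R : realType}.

(* Meant for open O. *)
Fixpoint Ck (k n m : nat) (O : set 'rV[R]_n) (f : 'rV[R]_n -> 'rV[R]_m) :
    Prop :=
  if k is k'.+1 then
    (forall u, O u -> differentiable f u) /\ forall v, Ck k' O ('D_v f)
  else forall u, O u -> {for u, continuous f}.

Definition Cinfty (n m : nat) (O : set 'rV[R]_n) (f : 'rV[R]_n -> 'rV[R]_m) :=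
  forall k, Ck k O f.

Record param (n : nat) (M : Type) := Param {
  pdom : set 'rV[R]_n;
  pmap : 'rV[R]_n -> M
}.

Definition atlas (n : nat) (M : Type) := set (param n M).

(* Near u, g is an extension of the expression of f (restricted to A) in the
   coordinates p and q. *)
Definition local_rep (n m : nat) (M N : topologicalType)
    (p : param n M) (q : param m N) (A : set M) (f : M -> N)
    (u : 'rV[R]_n) (g : 'rV[R]_n -> 'rV[R]_m) :=
  exists O : set 'rV[R]_n,
    [/\ open O, O u, Cinfty O g
      & forall u', O u' -> pdom p u' -> A (pmap p u') ->
          pdom q (g u') /\ pmap q (g u') = f (pmap p u')].

Definition smooth_on (n m : nat) (M N : topologicalType)
    (AM : atlas n M) (AN : atlas m N) (A : set M) (f : M -> N) :=
  {within A, continuous f} /\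
  forall a, A a -> exists p q u g,
    [/\ AM p, AN q, pdom p u, pmap p u = a & local_rep p q A f u g].

(* To be used with oriented atlases, and with A contained in the closure of its
   interior, so that the Jacobian of g at u does not depend on the extension. *)
Definition orientation_preserving_on (n : nat) (M N : topologicalType)
    (AM : atlas n M) (AN : atlas n N) (A : set M) (f : M -> N) :=
  forall a, A a -> exists p q u g,
    [/\ AM p /\ AN q, pdom p u, pmap p u = a, local_rep p q A f u g
      & 0 < \det (jacobian g u)].

Definition diffeo (n m : nat) (M N : topologicalType)
    (AM : atlas n M) (AN : atlas m N) (A : set M) (B : set N) (f : M -> N) :=
  [/\ smooth_on AM AN A f, f @` A = B
    & exists g : N -> M, smooth_on AN AM B g /\ forall a, A a -> g (f a) = a].

Definition embedding (n m : nat) (M N : topologicalType)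
    (AM : atlas n M) (AN : atlas m N) (A : set M) (f : M -> N) :=
  diffeo AM AN A (f @` A) f.

(* H is the model: the whole space, or a half space for manifolds with
   boundary. *)
Definition is_chart (n : nat) (M : topologicalType) (H : set 'rV[R]_n)
    (p : param n M) :=
  [/\ exists2 O, open O & pdom p = O `&` H,
      {within pdom p, continuous (pmap p)},
      set_inj (pdom p) (pmap p)
    & forall O, open O -> open (pmap p @` (pdom p `&` O))].

Definition manifold (n : nat) (M : topologicalType) (H : set 'rV[R]_n)
    (AM : atlas n M) :=
  [/\ hausdorff_space M, @second_countable M,
      forall x, exists p u, [/\ AM p, pdom p u & pmap p u = x],
      forall p, AM p -> is_chart H p
    & forall p q u v, AM p -> AM q -> pdom p u -> pdom q v ->
        pmap p u = pmap q v -> exists g, local_rep p q setT id u g].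

Definition closed_manifold (n : nat) (M : topologicalType) (AM : atlas n M) :=
  manifold setT AM /\ compact [set: M].

Definition halfspace (n : nat) : set 'rV[R]_n.+1 := [set u | 0 <= u 0 0].

Definition manifold_with_boundary (n : nat) (M : topologicalType)
    (AM : atlas n.+1 M) := manifold (@halfspace n) AM.

Definition boundary (n : nat) (M : topologicalType) (AM : atlas n.+1 M) :
    set M :=
  [set x | exists (p : param n.+1 M) (u : 'rV[R]_n.+1),
     [/\ AM p, pdom p u, u 0 0 = 0 & pmap p u = x]].

Definition oriented (n : nat) (M : topologicalType) (AM : atlas n M) :=
  forall p q u v, AM p -> AM q -> pdom p u -> pdom q v ->
    pmap p u = pmap q v ->
    exists g, local_rep p q setT id u g /\ 0 < \det (jacobian g u).

Definition prod_param (n m : nat) (M N : Type) (p : param n M)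
    (q : param m N) : param (n + m) (M * N) :=
  Param [set w | pdom p (lsubmx w) /\ pdom q (rsubmx w)]
        (fun w => (pmap p (lsubmx w), pmap q (rsubmx w))).

Definition prod_atlas (n m : nat) (M N : Type) (AM : atlas n M)
    (AN : atlas m N) : atlas (n + m) (M * N) :=
  [set w | exists p q, [/\ AM p, AN q & w = prod_param p q]].

(* Z is the manifold obtained from A (a subset of X) and #|K| copies of B
   (a subset of Y) by identifying a in A with the point b of the k-th copy of B
   when r k a b holds.  As the pieces are embedded as closed subsets and cover
   Z, for finite K the topology of Z is the quotient topology. *)
Definition glued (K : Type) (n : nat) (X Y Z : topologicalType)
    (AX : atlas n X) (AY : atlas n Y) (AZ : atlas n Z) (A : set X) (B : set Y)
    (r : K -> X -> Y -> Prop) (i : X -> Z) (j : K -> Y -> Z) :=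
  [/\ embedding AX AZ A i /\ forall k, embedding AY AZ B (j k),
      closed (i @` A) /\ forall k, closed (j k @` B),
      i @` A `|` \bigcup_k (j k @` B) = setT,
      forall k a b, A a -> B b -> (i a = j k b <-> r k a b)
    & forall k l, k <> l -> j k @` B `&` j l @` B = set0].

End Smooth.

Arguments param R n M : clear implicits.
Arguments atlas R n M : clear implicits.

(* Paths are functions on the real line considered on [0, 1] only.  A loop
   represents an element of a fundamental group, and equality in the
   fundamental group of the subspace A is path_homotopic A. *)
Section Paths.
Context {R : realType} {X : topologicalType}.
Implicit Types (A : set X) (f g : R -> X).

Definition path_cat f g : R -> X :=
  fun s => if s <= 2^-1 then f (2 * s) else g (2 * s - 1).

Definition path_rev f : R -> X := fun s => f (1 - s).

Definition path_comm f g :=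
  path_cat f (path_cat g (path_cat (path_rev f) (path_rev g))).

Definition unit_square : set (R * R) := `[0, 1] `*` `[0, 1].

Definition path_homotopic A f g := exists H : R * R -> X,
  [/\ {within unit_square, continuous H},
      H @` unit_square `<=` A,
      forall s, 0 <= s <= 1 -> H (s, 0) = f s /\ H (s, 1) = g s
    & forall u, 0 <= u <= 1 -> H (0, u) = f 0 /\ H (1, u) = f 1].

Definition loop_freely_homotopic A f g := exists H : R * R -> X,
  [/\ {within unit_square, continuous H},
      H @` unit_square `<=` A,
      forall s, 0 <= s <= 1 -> H (s, 0) = f s /\ H (s, 1) = g s
    & forall u, 0 <= u <= 1 -> H (0, u) = H (1, u)].

Definition pi1_trivial f := path_homotopic setT f (fun=> f 0).

End Paths.

Section Circle.
Context {R : realType}.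

Definition circle : set (R * R) := [set w | w.1 ^+ 2 + w.2 ^+ 2 = 1].
Definition disk : set (R * R) := [set w | w.1 ^+ 2 + w.2 ^+ 2 <= 1].
Definition open_disk : set (R * R) := [set w | w.1 ^+ 2 + w.2 ^+ 2 < 1].

Lemma cis_subproof (a : R) : (cos a, sin a) \in circle.
Proof. by apply/mem_set; exact: cos2Dsin2. Qed.

Definition cis (a : R) : circle := exist _ (cos a, sin a) (cis_subproof a).

Lemma conj_subproof (c : circle) : ((val c).1, - (val c).2) \in circle.
Proof.
apply/mem_set; rewrite /circle /= sqrrN.
by case: c => c /= /set_mem.
Qed.

Definition conj_circle (c : circle) : circle :=
  exist _ ((val c).1, - (val c).2) (conj_subproof c).

Definition circle_param (U : set 'rV[R]_1) : param R 1 circle :=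
  Param U (fun u => cis (u 0 0)).

Definition circle_atlas : atlas R 1 circle :=
  [set p | exists U, [/\ open U, set_inj U (fun u : 'rV[R]_1 => cis (u 0 0))
                       & p = circle_param U]].

Definition plane_atlas : atlas R 2 (R * R)%type :=
  [set Param setT (fun u : 'rV[R]_2 => (u 0 0, u 0 1))].

End Circle.

Notation S1 R := (set_type (@circle R)).
Notation T2 R := (S1 R * S1 R)%type.
Notation T4 R := (S1 R * S1 R * S1 R * S1 R)%type.

Section Torus.
Context {R : realType}.
Implicit Types (eps x y z t theta s : R).

Definition T2_atlas : atlas R 2 (T2 R) := prod_atlas circle_atlas circle_atlas.

Definition T4_atlas : atlas R 4 (T4 R) :=
  prod_atlas (prod_atlas (prod_atlas circle_atlas circle_atlas) circle_atlas)
             circle_atlas.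

Definition cis4 x y z t : T4 R := (cis x, cis y, cis z, cis t).

(* Coordinates adapted to the tori T_x, T_y and T_z, which are respectively
   y = z = 0, x = z = 0 and x = y = 0 in these coordinates. *)
Definition near_x x y z t := cis4 x (- (pi / 2) + y) (pi / 2 + z) t.
Definition near_y x y z t := cis4 (pi / 2 + x) y (- (pi / 2) + z) t.
Definition near_z x y z t := cis4 (- (pi / 2) + x) (pi / 2 + y) z t.

Definition Nbd_x eps : set (T4 R) := [set w | exists x y z t,
  y ^+ 2 + z ^+ 2 < eps ^+ 2 /\ w = near_x x y z t].
Definition Nbd_y eps : set (T4 R) := [set w | exists x y z t,
  x ^+ 2 + z ^+ 2 < eps ^+ 2 /\ w = near_y x y z t].
Definition Nbd_z eps : set (T4 R) := [set w | exists x y z t,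
  x ^+ 2 + y ^+ 2 < eps ^+ 2 /\ w = near_z x y z t].

Definition bNbd_x eps : set (T4 R) := [set w | exists x y z t,
  y ^+ 2 + z ^+ 2 = eps ^+ 2 /\ w = near_x x y z t].
Definition bNbd_y eps : set (T4 R) := [set w | exists x y z t,
  x ^+ 2 + z ^+ 2 = eps ^+ 2 /\ w = near_y x y z t].

Definition loop_x s := cis4 (2 * pi * s) 0 0 0.
Definition loop_y s := cis4 0 (2 * pi * s) 0 0.

(* Translates of the loops x and t to the boundaries of the neighborhoods of
   T_x and T_y, and meridians through the same points: mu_x turns from the
   y-direction to the z-direction, and mu_y from z to x. *)
Definition bloop_x eps s := near_x (2 * pi * s) eps 0 0.
Definition mu_x eps s :=
  near_x 0 (eps * cos (2 * pi * s)) (eps * sin (2 * pi * s)) 0.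
Definition bloop_t eps s := near_y 0 0 eps (2 * pi * s).
Definition mu_y eps s :=
  near_y (eps * sin (2 * pi * s)) 0 (eps * cos (2 * pi * s)) 0.

(* gx and gy are the gluing diffeomorphisms of the two copies of D^2 x T^2.
   The fundamental group of a 3-torus is abelian, so a free homotopy class of
   loops is an element of it. *)
Definition surgery_maps eps (gx gy : S1 R * T2 R -> T4 R) :=
  let AB := prod_atlas circle_atlas T2_atlas in
  [/\ diffeo AB T4_atlas setT (bNbd_x eps) gx,
      diffeo AB T4_atlas setT (bNbd_y eps) gy,
      forall p, loop_freely_homotopic (bNbd_x eps)
        (fun s : R => gx (cis (2 * pi * s), p))
        (path_cat (bloop_x eps) (path_rev (mu_x eps)))
    & forall p, loop_freely_homotopic (bNbd_y eps)
        (fun s : R => gy (cis (2 * pi * s), p))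
        (path_cat (bloop_t eps) (path_rev (mu_y eps)))].

Definition surgery_rel (gx gy : S1 R * T2 R -> T4 R) (k : bool)
    (a : T4 R) (b : (R * R) * T2 R) :=
  exists c p, b = (val c, p) /\ a = (if k then gx else gy) (c, p).

(* i is the inclusion of the complement of Nbd_x and Nbd_y; its values on
   these neighborhoods are irrelevant. *)
Definition is_T4sur eps (T : topologicalType) (AT : atlas R 4 T)
    (i : T4 R -> T) :=
  let X := ~` (Nbd_x eps `|` Nbd_y eps) in
  [/\ closed_manifold AT, oriented AT,
      orientation_preserving_on T4_atlas AT X i
    & exists gx gy (j : bool -> (R * R) * T2 R -> T), surgery_maps eps gx gy /\
        glued T4_atlas (prod_atlas plane_atlas T2_atlas) AT
              X (disk `*` setT) (surgery_rel gx gy) i j].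

Definition bpar_z eps z t theta :=
  near_z (eps * cos (theta - pi / 4)) (eps * sin (theta - pi / 4)) z t.

Definition phi_rel eps (T : topologicalType) (i : T4 R -> T) (_ : unit)
    (a b : T) :=
  exists z t theta, a = i (bpar_z eps z t theta) /\
                    b = i (bpar_z eps t (- z) (- theta)).

(* k1 and k2 are the inclusions of the two copies of T4sur minus Nbd(T_z). *)
Definition is_P eps (T : topologicalType) (AT : atlas R 4 T) (i : T4 R -> T)
    (P : topologicalType) (AP : atlas R 4 P) (k1 k2 : T -> P) :=
  let X := ~` (i @` Nbd_z eps) in
  [/\ closed_manifold AP, oriented AP,
      orientation_preserving_on AT AP X k1,
      orientation_preserving_on AT AP X k2
    & glued AT AT AP X X (phi_rel eps i) k1 (fun _ => k2)].

(* E_0 x {(z, t)} *)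
Definition E0 eps z t : set (T4 R) :=
  [set w | (exists x y, w = cis4 x y z t) /\ ~ Nbd_z eps w].

(* Sigma_P for delta = 0, and its push-off Sigma_{P,delta} for delta > 0. *)
Definition Sigma_P eps (P : topologicalType) (i1 i2 : T4 R -> P) (delta : R) :
    set P :=
  i1 @` E0 eps delta delta `|` i2 @` E0 eps delta (- delta).

Definition rho1 eps s :=
  cis4 (s * (- (pi / 2) + eps / Num.sqrt 2))
       (s * (pi / 2 - eps / Num.sqrt 2)) 0 0.

Definition e_z eps := rho1 eps 1.

Definition based eps (l : R -> T4 R) :=
  path_cat (path_rev (rho1 eps)) (path_cat l (rho1 eps)).

End Torus.

Section Surface.
Context {R : realType}.

(* The closed disk as an octagon: its boundary circle is divided
   counterclockwise into edges 0, ..., 7 reading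
   a1 b1 a1^-1 b1^-1 a2 b2 a2^-1 b2^-1. *)
Definition oct_edge (k : nat) (s : R) : R * R :=
  val (cis ((k%:R + s) * (pi / 4))).

Definition oct_rel (w w' : R * R) := exists k s,
  [/\ k \in [:: 0; 1; 4; 5]%N, 0 <= s <= 1,
      w = oct_edge k s & w' = oct_edge (k + 2)%N (1 - s)].

(* S is a closed oriented genus two surface and q exhibits it as an octagon
   with identified edges; as q preserves orientation, a1 . b1 = 1. *)
Definition is_genus2 (S : topologicalType) (AS : atlas R 2 S)
    (q : R * R -> S) :=
  [/\ closed_manifold AS /\ oriented AS,
      {within disk, continuous q},
      q @` disk = setT,
      forall w w', disk w -> disk w' ->
        (q w = q w' <-> clos_refl_sym_trans _ oct_rel w w')
    & embedding plane_atlas AS open_disk q /\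
      orientation_preserving_on plane_atlas AS open_disk q].

Context {S : topologicalType} (q : R * R -> S).
Definition sigma0 : S := q (1, 0).
Definition gen_a1 (s : R) := q (oct_edge 0 s).
Definition gen_b1 (s : R) := q (oct_edge 1 s).
Definition gen_a2 (s : R) := q (oct_edge 4 s).
Definition gen_b2 (s : R) := q (oct_edge 5 s).

End Surface.

Section Pieces.
Context {R : realType} (S : topologicalType) (AS : atlas R 2 S).
Context (q : R * R -> S).

(* The open subset Nbd(Sigma_{P,delta}) removed from P. *)
Definition Nbd_Sigma (P : topologicalType) (hP : S * (R * R) -> P) : set P :=
  hP @` (setT `*` open_disk).

(* Nbd_Sigma is automatically open by the inverse function theorem. *)
Definition is_hP (eps delta : R) (P : topologicalType) (AP : atlas R 4 P)
    (i1 i2 : T4 R -> P) (hP : S * (R * R) -> P) :=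
  let ASD := prod_atlas AS plane_atlas in
  let SP := Sigma_P eps i1 i2 0 in
  let along1 (l : R -> S) s := hP (l s, (1, 0)) in
  [/\ [/\ embedding ASD AP (setT `*` disk) hP,
          orientation_preserving_on ASD AP (setT `*` disk) hP
        & open (Nbd_Sigma hP)],
      hP @` (setT `*` [set (0, 0)]) = Sigma_P eps i1 i2 delta,
      hP @` (setT `*` [set (1, 0)]) = SP,
      hP (sigma0 q, (1, 0)) = i1 (e_z eps)
    & [/\ path_homotopic SP (along1 (gen_a1 q)) (i1 \o based eps loop_y),
          path_homotopic SP (along1 (gen_b1 q))
                         (i1 \o path_rev (based eps loop_x)),
          path_homotopic SP (along1 (gen_a2 q)) (i2 \o based eps loop_y)
        & path_homotopic SP (along1 (gen_b2 q))
                         (i2 \o path_rev (based eps loop_x))]].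

Definition is_Psi (Psi : S -> S) :=
  let: a1 := gen_a1 q in let: b1 := gen_b1 q in
  let: a2 := gen_a2 q in let: b2 := gen_b2 q in
  [/\ diffeo AS AS setT setT Psi, Psi (sigma0 q) = sigma0 q,
      path_homotopic setT (Psi \o a1)
                     (path_cat a1 (path_cat b1 (path_rev a1))) /\
      path_homotopic setT (Psi \o b1) (path_rev a1)
    & path_homotopic setT (Psi \o a2)
                     (path_cat a2 (path_cat b2 (path_rev a2))) /\
      path_homotopic setT (Psi \o b2) (path_rev a2)].

(* The graph of hP o (Psi x -Id) o hW^-1. *)
Definition glue_rel (W P : topologicalType) (hW : S * S1 R -> W)
    (Psi : S -> S) (hP : S * (R * R) -> P) (_ : unit) (a : W) (b : P) :=
  exists s c, a = hW (s, c) /\ b = hP (Psi s, val (conj_circle c)).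

Definition is_Z (W : topologicalType) (AW : atlas R 4 W) (hW : S * S1 R -> W)
    (Psi : S -> S) (P : topologicalType) (AP : atlas R 4 P)
    (hP : S * (R * R) -> P) (Z : topologicalType) (AZ : atlas R 4 Z)
    (jW : W -> Z) (jP : P -> Z) :=
  closed_manifold AZ /\
  glued AW AP AZ setT (~` Nbd_Sigma hP) (glue_rel hW Psi hP)
        jW (fun _ => jP).

End Pieces.

(* Main.v *)
Require Import Defs.
From Stdlib Require Morphisms.
From mathcomp Require Import all_boot all_order all_algebra.
From mathcomp Require Import all_classical all_reals all_analysis.
From mathcomp Require Import ring lra.
Import Order.TTheory GRing.Theory Num.Theory.
Import numFieldNormedType.Exports.
Local Open Scope classical_set_scope.
Local Open Scope ring_scope.

Set Implicit Arguments.
Unset Strict Implicit.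
Unset Printing Implicit Defensive.

(** Write g for the class of y'' x''^-1 y''^-1 in the group of Z.  The gluing
    along Psi carries b_1 to y'^-1 and a_2 to g, so y' commutes with g; it
    remains to see that x' does.  The surgery along T_x makes x' a meridian of
    T_x, and this meridian bounds a punctured torus in the directions y and z,
    so x' = z' y'^-1 z'^-1 y'.  The gluing phi identifies z' with the inverse
    of t'', which commutes with x'' and y'' because the two-tori x'' t'' and
    y'' t'' at z'' = 0 miss the push-off of Sigma_P.  Hence g commutes with
    t'', z' and y', thus with x'.

    The homotopies only avoid Sigma_{P,delta}; the radial retraction of its
    complement onto the complement of Nbd(Sigma_{P,delta}) fixes Sigma_P and
    moves them off the removed neighborhood.  In the torus every homotopy is
    the image of a straight-line homotopy in a box of R^4, in cartesian
    coordinates or in polar coordinates around T_x. *)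

(** * Continuity on subsets *)

(** The obstacle is that [hP] is an arbitrary embedding: nothing bounds how far the removed
    neighborhood reaches, so no explicit homotopy can be seen to miss it. What is under control is
    its core. The push-off has (z, t) = (delta, delta) on the first copy and (delta, -delta) on the
    second, two levels matched by phi, which sends (z, t) to (t, -z). As neither coordinate
    vanishes, it is missed by the slice t' = 0 of the first copy and by the slice z'' = 0 of the
    second, and these slices contain the two halves of Sigma_P, hence the loops of the statement.
    The bound on delta keeps the push-off away from the surgery neighborhoods, which lie near z =
    pi/2 and z = -pi/2.

    A punctured torus is not convex. It is therefore cut into four strips around the hole, one for
    each side of a fundamental square; their inner sides are quarter arcs of a circle slightly
    larger than the meridian.

    The surgery is specified by free homotopy only, so the disk it provides yields a relation up to
    conjugation by the track of the base point. This is harmless because the relation says that a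
    loop is trivial. *)

Section ContinuousFunctions.
Context {X : topologicalType}.

Lemma continuous_pair (Y Z : topologicalType) (f : X -> Y) (g : X -> Z) :
  continuous f -> continuous g -> continuous (fun x => (f x, g x)).
Proof. by move=> cf cg x; apply: cvg_pair; [exact: cf|exact: cg]. Qed.

Lemma continuous_fst_comp (Y Z : topologicalType) (f : X -> Y * Z) :
  continuous f -> continuous (fun x => (f x).1).
Proof. by move=> cf x; apply: (continuous_comp (cf x)); exact: cvg_fst. Qed.

Lemma continuous_snd_comp (Y Z : topologicalType) (f : X -> Y * Z) :
  continuous f -> continuous (fun x => (f x).2).
Proof. by move=> cf x; apply: (continuous_comp (cf x)); exact: cvg_snd. Qed.

Context {R : realType}.
Implicit Types f g : X -> R.

Lemma continuous_add f g : continuous f -> continuous g ->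
  continuous (fun x => f x + g x).
Proof. by move=> cf cg x; apply: cvgD; [exact: cf|exact: cg]. Qed.

Lemma continuous_opp f : continuous f -> continuous (fun x => - f x).
Proof. by move=> cf x; apply: cvgN; exact: cf. Qed.

Lemma continuous_mul f g : continuous f -> continuous g ->
  continuous (fun x => f x * g x).
Proof. by move=> cf cg x; apply: cvgM; [exact: cf|exact: cg]. Qed.

Lemma continuous_cos_comp f : continuous f -> continuous (fun x => cos (f x)).
Proof. by move=> cf x; apply: (continuous_comp (cf x)); exact: continuous_cos. Qed.

Lemma continuous_sin_comp f : continuous f -> continuous (fun x => sin (f x)).
Proof. by move=> cf x; apply: (continuous_comp (cf x)); exact: continuous_sin. Qed.

Lemma continuous_cis_comp f : continuous f -> continuous (fun x => cis (f x)).
Proof.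
move=> cf; apply: (@continuous_comp_initial _ _ _ (@set_val _ (@circle R))).
by apply: continuous_pair; [exact: continuous_cos_comp|exact: continuous_sin_comp].
Qed.

End ContinuousFunctions.

Lemma continuous_const (X Y : topologicalType) (y : Y) :
  continuous (fun _ : X => y).
Proof. by move=> x; exact: cvg_cst. Qed.

Lemma continuous_idfun (X : topologicalType) : continuous (fun x : X => x).
Proof. by move=> x; exact: cvg_id. Qed.

Ltac continuity :=
  lazymatch goal with
  | |- continuous (fun x => (_, _)) => apply: continuous_pair; continuity
  | |- continuous (fun x => _ + _) => apply: continuous_add; continuity
  | |- continuous (fun x => _ * _) => apply: continuous_mul; continuity
  | |- continuous (fun x => - _) => apply: continuous_opp; continuity
  | |- continuous (fun x => cos _) => apply: continuous_cos_comp; continuity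
  | |- continuous (fun x => sin _) => apply: continuous_sin_comp; continuity
  | |- continuous (fun x => x) => exact: continuous_idfun
  | |- continuous (fun x => _.1) => apply: continuous_fst_comp; continuity
  | |- continuous (fun x => _.2) => apply: continuous_snd_comp; continuity
  | |- continuous fst => exact: (continuous_fst_comp (@continuous_idfun _))
  | |- continuous snd => exact: (continuous_snd_comp (@continuous_idfun _))
  | |- continuous (fun x => cis _) => apply: continuous_cis_comp; continuity
  | |- continuous -%R => apply: continuous_opp; exact: continuous_idfun
  | |- continuous ( *%R _) => apply: continuous_mul; continuity
  | |- continuous idfun => exact: continuous_idfun
  | |- _ => first [exact: continuous_const | exact: continuous_idfun]
  end.

Section Within.
Context {X Y : topologicalType}.
Implicit Types (A B D : set X) (f g : X -> Y).

Lemma within_continuousP D f : {within D, continuous f} <->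
  forall x, D x -> f u @[u --> within D (nbhs x)] --> f x.
Proof. exact: subspace_continuousP. Qed.

Lemma within_continuousT D f : continuous f -> {within D, continuous f}.
Proof. exact: continuous_subspaceT. Qed.

Lemma within_continuous_eq D f g : (forall x, D x -> f x = g x) ->
  {within D, continuous f} -> {within D, continuous g}.
Proof.
by move=> fg; apply: subspace_eq_continuous => x /set_mem; exact: fg.
Qed.

(** At a point outside one of the closed pieces the complement of that piece is a neighborhood, so
    only the pieces through the point impose a condition there. *)
Lemma within_continuous_paste D A B f : closed A -> closed B ->
  D `<=` A `|` B -> {within D `&` A, continuous f} ->
  {within D `&` B, continuous f} -> {within D, continuous f}.
Proof.
move=> cA cB DAB /within_continuousP fA /within_continuousP fB.
apply/within_continuousP => x Dx U Ux.
have step C : closed C -> (C x -> f u @[u --> within (D `&` C) (nbhs x)] --> f x) ->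
    \forall u \near x, D u -> C u -> U (f u).
  move=> cC fC; have [Cx|nCx] := pselect (C x).
    have := fC Cx _ Ux; rewrite /nbhs /= /within /=.
    by apply: filterS => u h Du Cu; apply: h.
  have : nbhs x (~` C) by apply: open_nbhs_nbhs; split=> //; exact: closed_openC.
  by apply: filterS => u nC _ /nC.
have hA := step A cA (fun Ax => fA x (conj Dx Ax)).
have hB := step B cB (fun Bx => fB x (conj Dx Bx)).
rewrite /nbhs /= /within /=.
near=> u => Du.
have [Au|Bu] := DAB u Du.
- by move: Du Au; near: u.
- by move: Du Bu; near: u.
Unshelve. all: by end_near.
Qed.

End Within.

Lemma within_continuous_compose (X Y Z : topologicalType) (A : set X) (B : set Y)
    (f : X -> Y) (g : Y -> Z) : {within A, continuous f} ->
  (forall x, A x -> B (f x)) -> {within B, continuous g} ->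
  {within A, continuous (g \o f)}.
Proof.
move=> /within_continuousP fA AB /within_continuousP gB.
apply/within_continuousP => x Ax U /(gB _ (AB x Ax)) gU.
have := fA x Ax _ gU.
rewrite /nbhs /= /within /=.
by apply: filterS => u h Au; apply: (h Au); exact: AB.
Qed.

Lemma within_continuous_if (R : realType) (X Y : topologicalType) (D : set X)
    (c : X -> R) (k : R) (f g : X -> Y) : continuous c ->
  {within D `&` [set x | c x <= k], continuous f} ->
  {within D `&` [set x | k <= c x], continuous g} ->
  (forall x, D x -> c x = k -> f x = g x) ->
  {within D, continuous (fun x => if c x <= k then f x else g x)}.
Proof.
move=> cc cf cg fg.
apply: (@within_continuous_paste _ _ _ [set x | c x <= k] [set x | k <= c x]).
- exact: ((continuous_closedP c).1 cc _ (@closed_le R k)).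
- exact: ((continuous_closedP c).1 cc _ (@closed_ge R k)).
- by move=> x _ /=; case: (leP (c x) k) => h; [left|right; exact: ltW].
- by apply: within_continuous_eq cf => x [_ /= ->].
- apply: within_continuous_eq cg => x [Dx /= kc].
  by case: ifPn => // ck; rewrite fg //; apply/le_anti/andP.
Qed.

(** * Homotopies of paths relative to the endpoints *)

Section Homotopy.
Context {R : realType} {X : topologicalType}.
Implicit Types (A : set X) (f g h : R -> X).

Lemma in01P (s : R) : `[0, 1]%classic s <-> 0 <= s <= 1.
Proof. by rewrite /= in_itv. Qed.

Lemma unit_squareP (w : R * R) :
  unit_square w <-> 0 <= w.1 <= 1 /\ 0 <= w.2 <= 1.
Proof. by rewrite /unit_square /setX /= !in_itv. Qed.

Lemma path_homotopic_map (Y : topologicalType) A (F : X -> Y) f g :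
  {within A, continuous F} -> path_homotopic A f g ->
  path_homotopic setT (F \o f) (F \o g).
Proof.
move=> cF [H [cH HA H1 H2]]; exists (F \o H); split => //.
- apply: (within_continuous_compose cH _ cF) => w Dw.
  by apply: HA; exists w.
- by move=> s /H1 /= [-> ->].
- by move=> u /H2 /= [-> ->].
Qed.

Lemma path_homotopic_ext A f g f' g' : (forall s, 0 <= s <= 1 -> f s = f' s) ->
  (forall s, 0 <= s <= 1 -> g s = g' s) ->
  path_homotopic A f g -> path_homotopic A f' g'.
Proof.
move=> ff gg [H [cH HA H1 H2]]; exists H; split => //.
- by move=> s s01; rewrite -ff // -gg //; exact: H1.
- by move=> u /H2[-> ->]; rewrite !ff // ?lexx ?ler01.
Qed.

Lemma path_homotopic_start A f g : path_homotopic A f g -> f 0 = g 0.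
Proof.
move=> [H [_ _ H1 H2]].
by have [_ <-] := H1 0 ltac:(by rewrite lexx ler01);
  have [-> _] := H2 1 ltac:(by rewrite lexx ler01).
Qed.

Lemma path_homotopic_end A f g : path_homotopic A f g -> f 1 = g 1.
Proof.
move=> [H [_ _ H1 H2]].
by have [_ <-] := H1 1 ltac:(by rewrite lexx ler01);
  have [_ ->] := H2 1 ltac:(by rewrite lexx ler01).
Qed.

Lemma path_homotopic_sym A f g : path_homotopic A f g -> path_homotopic A g f.
Proof.
move=> fg; have f0 := path_homotopic_start fg; have f1 := path_homotopic_end fg.
case: fg => [H [cH HA H1 H2]].
exists (H \o (fun w => (w.1, 1 - w.2))); split.
- apply: (within_continuous_compose (B := unit_square) _ _ cH).
  + by apply: within_continuousT; continuity.
  + by move=> w /unit_squareP[? ?]; apply/unit_squareP => /=; lra.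
- move=> _ [w /unit_squareP[? ?] <-]; apply: HA.
  by exists (w.1, 1 - w.2) => //; apply/unit_squareP => /=; lra.
- by move=> s s01 /=; rewrite subr0 subrr; have [-> ->] := H1 s s01.
- by move=> u u01 /=; have [-> ->] := H2 (1 - u) ltac:(lra).
Qed.

Lemma path_homotopic_continuous A f g : path_homotopic A f g ->
  {within `[0, 1], continuous f}.
Proof.
move=> [H [cH _ H1 _]].
apply: (@within_continuous_eq _ _ _ (H \o (fun s => (s, 0)))).
  by move=> s /in01P /H1[].
apply: (within_continuous_compose (B := unit_square) _ _ cH).
- by apply: within_continuousT; continuity.
- by move=> s /in01P ?; apply/unit_squareP => /=; lra.
Qed.

Lemma path_homotopic_trans f g h : path_homotopic setT f g ->
  path_homotopic setT g h -> path_homotopic setT f h.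
Proof.
move=> fg gh; have f0 := path_homotopic_start fg; have f1 := path_homotopic_end fg.
move: fg gh => [H [cH _ H1 H2]] [K [cK _ K1 K2]].
exists (fun w => if w.2 <= 2^-1 then H (w.1, 2 * w.2) else K (w.1, 2 * w.2 - 1)).
split => //.
- apply: (@within_continuous_if _ _ _ _ (fun w => w.2)).
  + by continuity.
  + apply: (within_continuous_compose (B := unit_square) _ _ cH).
    * by apply: within_continuousT; continuity.
    * by move=> w [/unit_squareP[? ?]] /= ?; apply/unit_squareP => /=; lra.
  + apply: (within_continuous_compose (B := unit_square) _ _ cK).
    * by apply: within_continuousT; continuity.
    * by move=> w [/unit_squareP[? ?]] /= ?; apply/unit_squareP => /=; lra.
  + move=> w /unit_squareP[w1 _] w2; rewrite w2 divff ?subrr //.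
    by have [_ ->] := H1 _ w1; have [-> _] := K1 _ w1.
- move=> s s01 /=; rewrite invr_ge0 ler0n; split.
    by rewrite mulr0; have [-> _] := H1 s s01.
  rewrite (_ : (1 <= 2^-1 :> R) = false); last by apply/negbTE; rewrite -ltNge; lra.
  rewrite (_ : 2 * 1 - 1 = 1 :> R); last lra.
  by have [_ ->] := K1 s s01.
- move=> u u01 /=; case: ifPn => u2; first by apply: H2; lra.
  by rewrite f0 f1; apply: K2; lra.
Qed.

Lemma path_cat_continuous f g : {within `[0, 1], continuous f} ->
  {within `[0, 1], continuous g} -> f 1 = g 0 ->
  {within `[0, 1], continuous (path_cat f g)}.
Proof.
move=> cf cg fg; apply: (@within_continuous_if _ _ _ _ (fun s => s)).
- by continuity.
- refine (within_continuous_compose (X := R) (Y := R) (f := fun s => 2 * s)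
    (B := `[0, 1]%classic) _ _ cf).
    by apply: within_continuousT; continuity.
  by move=> s [/in01P ?] /= ?; apply/in01P; lra.
- refine (within_continuous_compose (X := R) (Y := R) (f := fun s => 2 * s - 1)
    (B := `[0, 1]%classic) _ _ cg).
    by apply: within_continuousT; continuity.
  by move=> s [/in01P ?] /= ?; apply/in01P; lra.
- by move=> s _ ->; rewrite divff // subrr.
Qed.

Lemma path_rev_continuous f : {within `[0, 1], continuous f} ->
  {within `[0, 1], continuous (path_rev f)}.
Proof.
move=> cf; refine (within_continuous_compose (X := R) (Y := R)
  (f := fun s => 1 - s) (B := `[0, 1]%classic) _ _ cf).
  by apply: within_continuousT; continuity.
by move=> s /in01P ?; apply/in01P; lra.
Qed.

Lemma path_cat0 f g : path_cat f g 0 = f 0.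
Proof. by rewrite /path_cat invr_ge0 ler0n mulr0. Qed.

Lemma path_cat1 f g : path_cat f g 1 = g 1.
Proof.
rewrite /path_cat (_ : (1 <= 2^-1 :> R) = false); last first.
  by apply/negbTE; rewrite -ltNge; lra.
by congr g; lra.
Qed.

Lemma path_rev0 f : path_rev f 0 = f 1.
Proof. by rewrite /path_rev subr0. Qed.

Lemma path_rev1 f : path_rev f 1 = f 0.
Proof. by rewrite /path_rev subrr. Qed.

Lemma path_homotopic_cat f f' g g' : f 1 = g 0 -> path_homotopic setT f f' ->
  path_homotopic setT g g' ->
  path_homotopic setT (path_cat f g) (path_cat f' g').
Proof.
move=> f1g0 [H [cH _ H1 H2]] [K [cK _ K1 K2]].
exists (fun w => if w.1 <= 2^-1 then H (2 * w.1, w.2) else K (2 * w.1 - 1, w.2)).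
split => //.
- apply: (@within_continuous_if _ _ _ _ (fun w => w.1)).
  + by continuity.
  + apply: (within_continuous_compose (B := unit_square) _ _ cH).
    * by apply: within_continuousT; continuity.
    * by move=> w [/unit_squareP[? ?]] /= ?; apply/unit_squareP => /=; lra.
  + apply: (within_continuous_compose (B := unit_square) _ _ cK).
    * by apply: within_continuousT; continuity.
    * by move=> w [/unit_squareP[? ?]] /= ?; apply/unit_squareP => /=; lra.
  + move=> w /unit_squareP[_ w2] w1; rewrite w1 divff ?subrr //.
    by have [_ ->] := H2 _ w2; have [-> _] := K2 _ w2.
- move=> s s01 /=; rewrite /path_cat; case: ifPn => ?; first by apply: H1; lra.
  by apply: K1; lra.
- move=> u u01 /=; rewrite path_cat0 path_cat1 invr_ge0 ler0n mulr0.
  rewrite (_ : (1 <= 2^-1 :> R) = false); last by apply/negbTE; rewrite -ltNge; lra.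
  rewrite (_ : 2 * 1 - 1 = 1 :> R); last lra.
  by have [-> _] := H2 u u01; have [_ ->] := K2 u u01.
Qed.

Lemma path_homotopic_rev f f' : path_homotopic setT f f' ->
  path_homotopic setT (path_rev f) (path_rev f').
Proof.
move=> [H [cH _ H1 H2]].
exists (H \o (fun w => (1 - w.1, w.2))); split => //.
- apply: (within_continuous_compose (B := unit_square) _ _ cH).
  + by apply: within_continuousT; continuity.
  + by move=> w /unit_squareP[? ?]; apply/unit_squareP => /=; lra.
- by move=> s s01 /=; apply: H1; lra.
- move=> u u01 /=; rewrite path_rev0 path_rev1 subr0 subrr.
  by have [-> ->] := H2 u u01.
Qed.

End Homotopy.

Definition convex_in (R : realType) (V : normedModType R) (D : set V) :=
  forall a b (t : R), D a -> D b -> 0 <= t <= 1 -> D (a + t *: (b - a)).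

Definition path_in (R : realType) (V : topologicalType) (D : set V)
    (f : R -> V) :=
  {within `[0, 1], continuous f} /\ forall s, 0 <= s <= 1 -> D (f s).

(** The straight-line homotopy. With [D] an interval it gives the reparametrizations behind the
    groupoid laws, with [D] a box of R^4 the homotopies in the torus, and with [D] the unit square
    the relations read off a given map of a square. *)
Lemma convex_homotopic (R : realType) (V : normedModType R) (D : set V)
    (f g : R -> V) : convex_in D -> path_in D f -> path_in D g ->
  f 0 = g 0 -> f 1 = g 1 -> path_homotopic D f g.
Proof.
move=> cvxD [cf Df] [cg Dg] f0 f1.
have on_fst (h : R -> V) : {within `[0, 1], continuous h} ->
    {within (@unit_square R), continuous (h \o fst)}.
  move=> ch; refine (within_continuous_compose (Y := R) (f := fst) _ _ ch).
    by apply: within_continuousT; continuity.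
  by move=> w /unit_squareP[? _]; apply/in01P.
exists (fun w => f w.1 + w.2 *: (g w.1 - f w.1)); split.
- apply/within_continuousP => w ww.
  have /within_continuousP/(_ _ ww) /= hf := on_fst f cf.
  have /within_continuousP/(_ _ ww) /= hg := on_fst g cg.
  apply: cvgD => //; apply: cvgZ; last exact: cvgB.
  have /within_continuousP/(_ _ ww) // : {within (@unit_square R), continuous snd}.
  by apply: within_continuousT; continuity.
- move=> _ [w /unit_squareP[? ?] <-]; apply: cvxD => //; [exact: Df|exact: Dg].
- by move=> s s01 /=; rewrite scale0r addr0 scale1r addrC subrK.
- by move=> u u01 /=; rewrite -f0 -f1 !subrr !scaler0 !addr0.
Qed.

(** * The fundamental groupoid *)

Section Groupoid.
Context {R : realType} {X : topologicalType}.

(** Continuity and endpoints are packed with the path, so that concatenation needs no side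
    conditions and homotopy becomes a congruence fit for rewriting. The bare functions of the
    theorem are lifted to this type only at the end. *)
Record tpath (x y : X) := Path {
  path_fun :> R -> X;
  path_cont : {within `[0, 1], continuous path_fun};
  path0 : path_fun 0 = x;
  path1 : path_fun 1 = y }.

Definition teq x y (p q : tpath x y) := path_homotopic setT p q.
Local Notation "p ~~ q" := (teq p q) (at level 70).

Definition tcat_cont x y z (p : tpath x y) (q : tpath y z) :=
  @path_cat_continuous _ _ p q (@path_cont _ _ p) (@path_cont _ _ q)
    (etrans (path1 p) (esym (path0 q))).

Definition tcat x y z (p : tpath x y) (q : tpath y z) : tpath x z :=
  Path (@tcat_cont _ _ _ p q) (etrans (path_cat0 p q) (path0 p))
    (etrans (path_cat1 p q) (path1 q)).

Definition tinv x y (p : tpath x y) : tpath y x :=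
  Path (@path_rev_continuous _ _ p (@path_cont _ _ p)) (etrans (path_rev0 p) (path1 p))
    (etrans (path_rev1 p) (path0 p)).

Definition tid x : tpath x x :=
  Path (within_continuousT (@continuous_const R X x)) (erefl x) (erefl x).

Lemma teq_refl x y (p : tpath x y) : p ~~ p.
Proof.
exists (p \o fst); split => //.
refine (within_continuous_compose (Y := R) (f := fst) _ _ (@path_cont _ _ p)).
  by apply: within_continuousT; continuity.
by move=> w /unit_squareP[? _]; apply/in01P.
Qed.

Lemma teq_sym x y (p q : tpath x y) : p ~~ q -> q ~~ p.
Proof. exact: path_homotopic_sym. Qed.

Lemma teq_trans x y (p q r : tpath x y) : p ~~ q -> q ~~ r -> p ~~ r.
Proof. exact: path_homotopic_trans. Qed.

Lemma teq_ext x y (p q : tpath x y) :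
  (forall s, 0 <= s <= 1 -> p s = q s) -> p ~~ q.
Proof. by move=> pq; apply: path_homotopic_ext (teq_refl p). Qed.

Lemma tcat_teq x y z (p p' : tpath x y) (q q' : tpath y z) :
  p ~~ p' -> q ~~ q' -> tcat p q ~~ tcat p' q'.
Proof. by apply: path_homotopic_cat; rewrite path1 path0. Qed.

Lemma tinv_teq x y (p p' : tpath x y) : p ~~ p' -> tinv p ~~ tinv p'.
Proof. exact: path_homotopic_rev. Qed.

Lemma convex_in01 : convex_in (V := R) `[0, 1]%classic.
Proof.
move=> a b t /in01P a01 /in01P b01 t01; apply/in01P.
rewrite /GRing.scale /=; nra.
Qed.

(** Both paths run through [r], with parameters [u] and [v]; the straight-line homotopy from [u] to
    [v] is pushed forward by [r]. The unit laws, associativity and the cancellation of a path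
    against its inverse are all instances. *)
Lemma reparam_teq x y a b (p q : tpath x y) (r : tpath a b) (u v : R -> R) :
  path_in (V := R) `[0, 1]%classic u -> path_in (V := R) `[0, 1]%classic v ->
  u 0 = v 0 -> u 1 = v 1 ->
  (forall s, 0 <= s <= 1 -> p s = r (u s)) ->
  (forall s, 0 <= s <= 1 -> q s = r (v s)) -> p ~~ q.
Proof.
move=> uI vI u0 u1 pE qE.
have := convex_homotopic convex_in01 uI vI u0 u1.
move=> /(path_homotopic_map (@path_cont _ _ r)).
by apply: path_homotopic_ext => s /= s01; rewrite ?pE ?qE.
Qed.

Lemma teq_idl x y (p : tpath x y) : tcat (tid x) p ~~ p.
Proof.
apply: (reparam_teq (r := p) (u := path_cat (fun=> 0) idfun) (v := idfun)).
- split; first apply: path_cat_continuous => //.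
  + by apply: within_continuousT; continuity.
  + by apply: within_continuousT; continuity.
  + by move=> s ?; apply/in01P; rewrite /path_cat /=; case: ifPn => ?; lra.
- by split; [apply: within_continuousT; continuity|move=> s ?; apply/in01P].
- by rewrite path_cat0.
- by rewrite path_cat1.
- by move=> s s01; rewrite /= /path_cat; case: ifPn => //; rewrite path0.
- by [].
Qed.

Lemma teq_idr x y (p : tpath x y) : tcat p (tid y) ~~ p.
Proof.
apply: (reparam_teq (r := p) (u := path_cat idfun (fun=> 1)) (v := idfun)).
- split; first apply: path_cat_continuous => //.
  + by apply: within_continuousT; continuity.
  + by apply: within_continuousT; continuity.
  + by move=> s ?; apply/in01P; rewrite /path_cat /=; case: ifPn => ?; lra.
- by split; [apply: within_continuousT; continuity|move=> s ?; apply/in01P].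
- by rewrite path_cat0.
- by rewrite path_cat1.
- by move=> s s01; rewrite /= /path_cat; case: ifPn => //; rewrite path1.
- by [].
Qed.

Lemma teq_invr x y (p : tpath x y) : tcat p (tinv p) ~~ tid x.
Proof.
apply: (reparam_teq (r := p) (u := path_cat idfun (path_rev idfun))
  (v := fun=> 0)).
- split; first apply: path_cat_continuous => //.
  + by apply: within_continuousT; continuity.
  + by apply: within_continuousT; rewrite /path_rev /=; continuity.
  + by rewrite path_rev0.
  + by move=> s ?; apply/in01P; rewrite /path_cat /path_rev /=; case: ifPn => ?; lra.
- split; first by apply: within_continuousT; continuity.
  by move=> s ?; apply/in01P; lra.
- by rewrite path_cat0.
- by rewrite path_cat1 path_rev1.
- by move=> s s01; rewrite /= /path_cat /path_rev; case: ifPn.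
- by move=> s _; rewrite path0.
Qed.

Lemma tinvK x y (p : tpath x y) : tinv (tinv p) ~~ p.
Proof. by apply: teq_ext => s _; rewrite /= /path_rev opprB addrC subrK. Qed.

Lemma teq_invl x y (p : tpath x y) : tcat (tinv p) p ~~ tid y.
Proof.
apply: teq_trans (teq_invr (tinv p)).
by apply: tcat_teq; [exact: teq_refl|exact: teq_sym (tinvK p)].
Qed.

Lemma teq_assoc x y z t (p : tpath x y) (q : tpath y z) (r : tpath z t) :
  tcat (tcat p q) r ~~ tcat p (tcat q r).
Proof.
(* [u] maps [0, 1/4], [1/4, 1/2], [1/2, 1] affinely onto [0, 1/2], [1/2, 3/4], [3/4, 1]: these are
   the intervals that the two bracketings assign to [p], [q], [r]. *)
apply: (reparam_teq (r := tcat p (tcat q r)) (v := idfun)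
  (u := path_cat (path_cat ( *%R 2^-1) (fun s => s / 4 + 2^-1))
                 (fun s => s / 4 + 3 / 4))).
- split; first apply: path_cat_continuous => //.
  + apply: path_cat_continuous.
    * by apply: within_continuousT; continuity.
    * by apply: within_continuousT; continuity.
    * lra.
  + by apply: within_continuousT; continuity.
  + by rewrite path_cat1; lra.
  + move=> s ?; apply/in01P; rewrite /path_cat /=.
    by case: ifPn => ?; [case: ifPn => ?|]; lra.
- by split; [apply: within_continuousT; continuity|move=> s ?; apply/in01P].
- by rewrite !path_cat0; lra.
- by rewrite path_cat1 /=; lra.
- move=> s s01; rewrite /= /path_cat; case: ifPn; rewrite -?ltNge => s2.
    case: ifPn; rewrite -?ltNge => s4.
      rewrite (_ : _ <= _ = true); last by lra.
      by congr (p _); lra.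
    rewrite (_ : _ <= _ = false); last by apply/negbTE; rewrite -ltNge; lra.
    rewrite (_ : _ <= _ = true); last by lra.
    by congr (q _); lra.
  rewrite (_ : _ <= _ = false); last by apply/negbTE; rewrite -ltNge; lra.
  rewrite (_ : _ <= _ = false); last by apply/negbTE; rewrite -ltNge; lra.
  by congr (r _); lra.
- by [].
Qed.

End Groupoid.

Arguments tpath R {X} x y.

#[global] Hint Extern 0 (teq _ _) => exact: teq_refl : core.

(** * Conjugation and commutation in the groupoid *)

Section GroupoidAlgebra.
Context {R : realType} {X : topologicalType}.
Local Notation "p ~~ q" := (teq p q) (at level 70).

#[global] Instance teq_equivalence (x y : X) :
  RelationClasses.Equivalence (@teq R X x y).
Proof.
by split; [exact: teq_refl|exact: teq_sym|exact: teq_trans].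
Qed.

#[global] Instance tcat_proper (x y z : X) : Morphisms.Proper
  (Morphisms.respectful (@teq R X x y) (Morphisms.respectful (@teq R X y z)
     (@teq R X x z))) (@tcat R X x y z).
Proof. by move=> p p' pp' q q' qq'; exact: tcat_teq. Qed.

#[global] Instance tinv_proper (x y : X) : Morphisms.Proper
  (Morphisms.respectful (@teq R X x y) (@teq R X y x)) (@tinv R X x y).
Proof. by move=> p p'; exact: tinv_teq. Qed.

Lemma tcat_tinvK (x y z : X) (p : tpath R x y) (q : tpath R x z) :
  tcat p (tcat (tinv p) q) ~~ q.
Proof. by rewrite -teq_assoc teq_invr teq_idl. Qed.

Lemma tinv_tcatK (x y z : X) (p : tpath R x y) (q : tpath R y z) :
  tcat (tinv p) (tcat p q) ~~ q.
Proof. by rewrite -teq_assoc teq_invl teq_idl. Qed.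

Lemma tcat_injr (x y z : X) (p q : tpath R x y) (r : tpath R y z) :
  tcat p r ~~ tcat q r -> p ~~ q.
Proof.
by move=> e; rewrite -(teq_idr p) -(teq_invr r) -teq_assoc e teq_assoc teq_invr teq_idr.
Qed.

Lemma tcat_injl (x y z : X) (p q : tpath R y z) (r : tpath R x y) :
  tcat r p ~~ tcat r q -> p ~~ q.
Proof. by move=> e; rewrite -(tinv_tcatK r p) e tinv_tcatK. Qed.

(** One notion for two uses: for a path [p] it says that [b] is [a] transported along [p], and for a
    loop [p] with [a = b] it says that [p] and [a] commute. Change of base point and commutation
    then obey the same rules. *)
Definition intertwines (x y : X) (p : tpath R x y) (a : tpath R x x)
  (b : tpath R y y) := tcat a p ~~ tcat p b.

Lemma intertwines_tcat (x y z : X) (p : tpath R x y) (q : tpath R y z) a b c :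
  intertwines p a b -> intertwines q b c -> intertwines (tcat p q) a c.
Proof. by rewrite /intertwines => ab bc; rewrite -teq_assoc ab teq_assoc bc teq_assoc. Qed.

Lemma intertwines_tinv (x y : X) (p : tpath R x y) a b :
  intertwines p a b -> intertwines (tinv p) b a.
Proof.
rewrite /intertwines => ab; apply: (tcat_injl (r := p)).
by rewrite -teq_assoc -ab teq_assoc teq_invr teq_idr tcat_tinvK.
Qed.

Lemma intertwines_mul (x y : X) (p : tpath R x y) a b a' b' :
  intertwines p a b -> intertwines p a' b' ->
  intertwines p (tcat a a') (tcat b b').
Proof. by rewrite /intertwines => ab ab'; rewrite teq_assoc ab' -teq_assoc ab teq_assoc. Qed.

Lemma intertwines_inv (x y : X) (p : tpath R x y) a b :
  intertwines p a b -> intertwines p (tinv a) (tinv b).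
Proof.
rewrite /intertwines => ab; apply: (tcat_injl (r := a)).
by rewrite tcat_tinvK -teq_assoc ab teq_assoc teq_invr teq_idr.
Qed.

Lemma intertwines_conj (x y : X) (p : tpath R x y) a b :
  intertwines p a b -> tcat (tinv p) (tcat a p) ~~ b.
Proof. by rewrite /intertwines => ->; rewrite tinv_tcatK. Qed.

Lemma intertwines_sym (x : X) (a b : tpath R x x) :
  intertwines a b b -> intertwines b a a.
Proof. by move=> ab; exact: teq_sym. Qed.

Lemma commutator_trivialP (x : X) (a b : tpath R x x) :
  tcat a (tcat b (tcat (tinv a) (tinv b))) ~~ tid x <-> intertwines b a a.
Proof.
rewrite /intertwines; split=> e.
  apply: (tcat_injr (r := tcat (tinv a) (tinv b))); rewrite !teq_assoc e.
  by rewrite tcat_tinvK teq_invr.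
by rewrite -teq_assoc e teq_assoc tcat_tinvK teq_invr.
Qed.

End GroupoidAlgebra.

(** * Trigonometry and neighborhoods of the tori *)

Section Trigonometry.
Context {R : realType}.
Implicit Types (a b eta x y z t : R).

Lemma cis_cos a b : cis a = cis b -> cos a = cos b.
Proof. by move/(congr1 (fst \o val)). Qed.

Lemma cis_sin a b : cis a = cis b -> sin a = sin b.
Proof. by move/(congr1 (snd \o val)). Qed.

Lemma cisD2pi a : cis (a + 2 * pi) = cis a.
Proof.
by apply: val_inj => /=; rewrite (mulr_natl pi 2) (cosD2pi a) (sinD2pi a).
Qed.

Lemma sinNpihalfD a : sin (- (pi / 2) + a) = - cos a.
Proof. by rewrite addrC sinBpihalf. Qed.

Lemma sin_pihalfD a : sin (pi / 2 + a) = cos a.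
Proof. by rewrite addrC sinDpihalf. Qed.

Lemma norm_in0pi b : `|b| <= pi -> `|b| \in `[0, pi].
Proof. by move=> bpi; rewrite in_itv /= normr_ge0. Qed.

Lemma cos_lt_norm b eta : 0 <= eta <= pi -> `|b| <= pi ->
  (cos eta < cos b) = (`|b| < eta).
Proof.
move=> eta0 bpi; rewrite -(cos_norm b) ltr_cos ?norm_in0pi ?in_itv //.
Qed.

Lemma cos_le_norm b eta : 0 <= eta <= pi -> `|b| <= pi ->
  (cos b <= cos eta) = (eta <= `|b|).
Proof. by move=> e0 bpi; rewrite leNgt cos_lt_norm // -leNgt. Qed.

Lemma cos_eq_sqr a b : `|a| <= pi -> `|b| <= pi -> cos a = cos b ->
  a ^+ 2 = b ^+ 2.
Proof.
move=> api bpi; rewrite -(cos_norm a) -(cos_norm b).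
move=> /cos_inj; rewrite !norm_in0pi // => /(_ isT isT) ab.
by rewrite -(real_normK (num_real a)) -(real_normK (num_real b)) ab.
Qed.

Lemma norm_lt_of_sum_sqr a b eta : 0 < eta ->
  a ^+ 2 + b ^+ 2 < eta ^+ 2 -> `|a| < eta.
Proof.
move=> eta0 ab; rewrite -(ltr_pXn2r (n := 2)) ?nnegrE ?normr_ge0 ?(ltW eta0) //.
rewrite real_normK ?num_real //; apply: le_lt_trans ab.
by rewrite lerDl sqr_ge0.
Qed.

Lemma norm_le_of_sum_sqr a b eta : 0 < eta ->
  a ^+ 2 + b ^+ 2 <= eta ^+ 2 -> `|a| <= eta.
Proof.
move=> eta0 ab; rewrite -(ler_pXn2r (n := 2)) ?nnegrE ?normr_ge0 ?(ltW eta0) //.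
rewrite real_normK ?num_real //; apply: le_trans ab.
by rewrite lerDl sqr_ge0.
Qed.

End Trigonometry.

Section Regions.
Context {R : realType}.
Variable eps : R.
Hypothesis heps : 0 < eps <= pi / 30.
Implicit Types (a b eta x y z t : R).

Local Lemma eps_gt0 : 0 < eps. Proof. by case/andP: heps. Qed.
Local Lemma pi2 : 2 <= pi :> R. Proof. exact: pi_ge2. Qed.
Local Lemma eps_le : eps <= pi / 30. Proof. by case/andP: heps. Qed.

Lemma cos_eps_gt0 : 0 < cos eps.
Proof.
apply: cos_gt0_pihalf; have := eps_gt0; have := pi2; have := eps_le; lra.
Qed.

Lemma cos_lt_cos_eps a b : a ^+ 2 + b ^+ 2 < eps ^+ 2 -> cos eps < cos a.
Proof.
have := eps_gt0; have := pi2; have := eps_le => ? ? ? /norm_lt_of_sum_sqr aeps.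
rewrite cos_lt_norm; first by apply: aeps; lra.
  lra.
by apply: ltW; apply: lt_le_trans (aeps _) _; lra.
Qed.

Lemma cos_le_cos_eps a b : a ^+ 2 + b ^+ 2 = eps ^+ 2 -> cos eps <= cos a.
Proof.
have := eps_gt0; have := pi2; have := eps_le => ? ? ? ab.
have aeps : `|a| <= eps by apply: (norm_le_of_sum_sqr (b := b)); rewrite ?ab.
rewrite -(cos_norm a) leNgt ltr_cos ?in_itv /= ?normr_ge0 -?leNgt //; lra.
Qed.

Lemma cis4_inj x y z t x' y' z' t' : cis4 x y z t = cis4 x' y' z' t' ->
  [/\ cis x = cis x', cis y = cis y', cis z = cis z' & cis t = cis t'].
Proof.
move=> e; split; first exact: (congr1 (fun w => w.1.1.1) e).
- exact: (congr1 (fun w => w.1.1.2) e).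
- exact: (congr1 (fun w => w.1.2) e).
- exact: (congr1 snd e).
Qed.

(** Sines are periodic, so no representative of an angle has to be chosen: T_x lies where sin y = -1
    and sin z = 1. The conditions describe a square containing the disk, which suffices for showing
    that a point is outside. *)
Lemma Nbd_xE x y z t : Nbd_x eps (cis4 x y z t) ->
  sin y < - cos eps /\ cos eps < sin z.
Proof.
move=> [x' [y' [z' [t' [yz /cis4_inj[_ /cis_sin -> /cis_sin -> _]]]]]].
rewrite sinNpihalfD sin_pihalfD ltrN2; split; first exact: cos_lt_cos_eps yz.
by apply: (@cos_lt_cos_eps _ y'); rewrite addrC.
Qed.

Lemma Nbd_yE x y z t : Nbd_y eps (cis4 x y z t) ->
  cos eps < sin x /\ sin z < - cos eps.
Proof.
move=> [x' [y' [z' [t' [yz /cis4_inj[/cis_sin -> _ /cis_sin -> _]]]]]].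
rewrite sinNpihalfD sin_pihalfD ltrN2; split; first exact: cos_lt_cos_eps yz.
by apply: (@cos_lt_cos_eps _ x'); rewrite addrC.
Qed.

Lemma Nbd_zE x y z t : Nbd_z eps (cis4 x y z t) ->
  sin x < - cos eps /\ cos eps < sin y.
Proof.
move=> [x' [y' [z' [t' [yz /cis4_inj[/cis_sin -> /cis_sin -> _ _]]]]]].
rewrite sinNpihalfD sin_pihalfD ltrN2; split; first exact: cos_lt_cos_eps yz.
by apply: (@cos_lt_cos_eps _ x'); rewrite addrC.
Qed.

(** The sine test replaces the disk by a square and is too coarse near the boundary circle. For
    offsets in [-pi, pi] the cosine determines the square of the offset, which recovers the exact
    distance. *)
Lemma near_x_notin_Nbd_x x y z t : eps ^+ 2 <= y ^+ 2 + z ^+ 2 ->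
  `|y| <= pi -> `|z| <= pi -> ~ Nbd_x eps (near_x x y z t).
Proof.
have := eps_gt0; have := pi2; have := eps_le => ? ? ? yz ypi zpi.
move=> [x' [y' [z' [t' [yz' /cis4_inj[_ /cis_sin ey /cis_sin ez _]]]]]].
have y'eps := norm_lt_of_sum_sqr eps_gt0 yz'.
have z'eps : `|z'| < eps.
  by apply: (norm_lt_of_sum_sqr (b := y') eps_gt0); rewrite addrC.
move: ey ez; rewrite !sinNpihalfD !sin_pihalfD => /oppr_inj ey ez.
move: yz'; rewrite -(cos_eq_sqr ypi _ ey); last lra.
by rewrite -(cos_eq_sqr zpi _ ez) ?ltNge ?yz //; lra.
Qed.

(* Both offsets from the centre are at least [eps / sqrt 2]. *)
Lemma notin_Nbd_z x y z t :
  sin x >= - cos (eps / Num.sqrt 2) -> sin y <= cos (eps / Num.sqrt 2) ->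
  ~ Nbd_z eps (cis4 x y z t).
Proof.
have := eps_gt0; have := pi2; have := eps_le => ? ? ? hx hy.
set eta := eps / _ in hx hy.
have s2 : 0 < Num.sqrt 2 :> R by rewrite sqrtr_gt0.
have eta2 : eta ^+ 2 + eta ^+ 2 = eps ^+ 2.
  by rewrite /eta expr_div_n sqr_sqrtr //; lra.
have eta0 : 0 < eta by rewrite /eta divr_gt0.
have etaeps : eta <= eps by nra.
move=> [x' [y' [z' [t' [xy /cis4_inj[/cis_sin ex /cis_sin ey _ _]]]]]].
have x'eps := norm_lt_of_sum_sqr eps_gt0 xy.
have y'eps : `|y'| < eps.
  by apply: (norm_lt_of_sum_sqr (b := x') eps_gt0); rewrite addrC.
move: hx hy; rewrite ex ey sinNpihalfD sin_pihalfD lerN2.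
rewrite !cos_le_norm ?eta0; try lra.
move=> hx hy; have := real_normK (num_real x'); have := real_normK (num_real y').
nra.
Qed.

(** What remains of one copy of the torus once the surgeries, the gluing along T_z and the push-off
    are taken out; the levels ([dz], [dt]) used are (delta, delta) and (delta, -delta). *)
Definition complement_region dz dt : set (T4 R) :=
  [set w | [/\ ~ (Nbd_x eps `|` Nbd_y eps) w, ~ Nbd_z eps w & ~ E0 eps dz dt w]].

Lemma complement_regionP dz dt x y z t :
  ~ (sin y < - cos eps /\ cos eps < sin z) ->
  ~ (cos eps < sin x /\ sin z < - cos eps) ->
  ~ Nbd_z eps (cis4 x y z t) -> ~ (cis z = cis dz /\ cis t = cis dt) ->
  complement_region dz dt (cis4 x y z t).
Proof.
move=> nx ny nz nd; split => //.
- by case=> [/Nbd_xE|/Nbd_yE].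
- by move=> [[x' [y' /cis4_inj[_ _ ? ?]]] _]; apply: nd.
Qed.

End Regions.

(** * Homotopies through convex boxes *)

Section Squares.
Context {R : realType}.
Local Notation "p ~~ q" := (teq p q) (at level 70).

Lemma path_in_cat (V : topologicalType) (D : set V) (f g : R -> V) :
  path_in D f -> path_in D g -> f 1 = g 0 -> path_in D (path_cat f g).
Proof.
move=> [cf Df] [cg Dg] fg; split; first exact: path_cat_continuous.
by move=> s s01; rewrite /path_cat; case: ifPn => ?; [apply: Df|apply: Dg]; lra.
Qed.

(** The two ways around a square are homotopic as soon as its sides lift to a convex set. The sides
    may be curved there, which the arcs around T_x require. *)
Lemma square_teq (V : normedModType R) (X : topologicalType) (D : set V)
    (F : V -> X) (a b c d : R -> V) (x y y' z : X) (p : tpath R x y)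
    (q : tpath R y z) (p' : tpath R x y') (q' : tpath R y' z) :
  convex_in D -> {within D, continuous F} ->
  path_in D a -> path_in D b -> path_in D c -> path_in D d ->
  a 0 = c 0 -> a 1 = b 0 -> c 1 = d 0 -> b 1 = d 1 ->
  (forall s, 0 <= s <= 1 -> p s = F (a s)) ->
  (forall s, 0 <= s <= 1 -> q s = F (b s)) ->
  (forall s, 0 <= s <= 1 -> p' s = F (c s)) ->
  (forall s, 0 <= s <= 1 -> q' s = F (d s)) ->
  tcat p q ~~ tcat p' q'.
Proof.
move=> cD cF Da Db Dc Dd ac ab cd bd pa qb pc qd.
have := convex_homotopic cD (path_in_cat Da Db ab) (path_in_cat Dc Dd cd).
rewrite !path_cat0 !path_cat1 => /(_ ac bd) /(path_homotopic_map cF).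
apply: path_homotopic_ext => s s01; rewrite /= /path_cat; case: ifPn => s2.
- by rewrite pa //; lra.
- by rewrite qb //; lra.
- by rewrite pc //; lra.
- by rewrite qd //; lra.
Qed.

Lemma image_path_continuous (V X : topologicalType) (D : set V) (F : V -> X)
    (f : R -> V) : {within D, continuous F} -> path_in D f ->
  {within `[0, 1], continuous (F \o f)}.
Proof.
move=> cF [cf Df]; refine (@within_continuous_compose _ _ _ _ _ _ _ cf _ cF).
by move=> s /in01P; exact: Df.
Qed.

Definition image_path (V X : topologicalType) (D : set V) (F : V -> X)
    (f : R -> V) (cF : {within D, continuous F}) (Df : path_in D f) (x y : X)
    (e0 : F (f 0) = x) (e1 : F (f 1) = y) : tpath R x y :=
  Path (@image_path_continuous _ _ _ _ _ cF Df) e0 e1.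

(** Bounds may coincide in some coordinates, so that rectangles and solids inside the slices t = 0
    and z = 0 are boxes too. *)
Definition box (l h : R * R * R * R) : set (R * R * R * R) :=
  [set v | [/\ l.1.1.1 <= v.1.1.1 <= h.1.1.1, l.1.1.2 <= v.1.1.2 <= h.1.1.2,
     l.1.2 <= v.1.2 <= h.1.2 & l.2 <= v.2 <= h.2]].

Definition seg (a b : R * R * R * R) (s : R) : R * R * R * R :=
  (a.1.1.1 + s * (b.1.1.1 - a.1.1.1), a.1.1.2 + s * (b.1.1.2 - a.1.1.2),
   a.1.2 + s * (b.1.2 - a.1.2), a.2 + s * (b.2 - a.2)).

Lemma convex_box l h : convex_in (box l h).
Proof.
move=> a b t [a1 a2 a3 a4] [b1 b2 b3 b4] t01.
have step (x y u v : R) : u <= x <= v -> u <= y <= v ->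
    u <= x + t * (y - x) <= v by move=> ? ?; apply/andP; split; nra.
by split; apply: step.
Qed.

Lemma path_in_seg l h a b : box l h a -> box l h b -> path_in (box l h) (seg a b).
Proof.
move=> la lb; split.
  by apply: within_continuousT; rewrite /seg; continuity.
by move=> s s01; have := convex_box la lb s01.
Qed.

Lemma seg0 a b : seg a b 0 = a.
Proof. by case: a => [[[a1 a2] a3] a4]; rewrite /seg /= !mul0r !addr0. Qed.

Lemma seg1 a b : seg a b 1 = b.
Proof.
case: a => [[[a1 a2] a3] a4]; case: b => [[[b1 b2] b3] b4].
by rewrite /seg /= !mul1r !(addrC _ (_ - _)) !subrK.
Qed.

Definition seg_path (X : topologicalType) (l h : R * R * R * R)
    (F : R * R * R * R -> X) (cF : {within box l h, continuous F}) a b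
    (la : box l h a) (lb : box l h b) (x y : X) (e0 : F a = x) (e1 : F b = y) :
    tpath R x y :=
  image_path cF (path_in_seg la lb) (etrans (congr1 F (seg0 a b)) e0)
    (etrans (congr1 F (seg1 a b)) e1).

Lemma seg_path_exists (X : topologicalType) (l h : R * R * R * R)
    (F : R * R * R * R -> X) a b (x y : X) :
  {within box l h, continuous F} -> box l h a -> box l h b ->
  F a = x -> F b = y ->
  exists p : tpath R x y, forall s, 0 <= s <= 1 -> p s = F (seg a b s).
Proof. by move=> cF la lb e0 e1; exists (seg_path cF la lb e0 e1). Qed.

Lemma box_square_teq (X : topologicalType) (l h : R * R * R * R)
    (F : R * R * R * R -> X) a b c d (x y y' z : X) (p : tpath R x y)
    (q : tpath R y z) (p' : tpath R x y') (q' : tpath R y' z) :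
  {within box l h, continuous F} ->
  box l h a -> box l h b -> box l h c -> box l h d ->
  (forall s, 0 <= s <= 1 -> p s = F (seg a b s)) ->
  (forall s, 0 <= s <= 1 -> q s = F (seg b d s)) ->
  (forall s, 0 <= s <= 1 -> p' s = F (seg a c s)) ->
  (forall s, 0 <= s <= 1 -> q' s = F (seg c d s)) ->
  tcat p q ~~ tcat p' q'.
Proof.
move=> cF la lb lc ld.
by apply: square_teq (@convex_box l h) cF _ _ _ _ _ _ _ _;
  rewrite ?seg0 ?seg1 //; exact: path_in_seg.
Qed.

End Squares.


Section TorusMaps.
Context {R : realType}.

Definition torus_point (v : R * R * R * R) : T4 R :=
  cis4 v.1.1.1 v.1.1.2 v.1.2 v.2.

Lemma continuous_torus_point : continuous torus_point.
Proof. by rewrite /torus_point /cis4; continuity. Qed.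

(** Polar coordinates around T_x, in the order x, radius, angle, t; the angle turns from y to z, as
    [mu_x] does. *)
Definition polar_point (v : R * R * R * R) : T4 R :=
  near_x v.1.1.1 (v.1.1.2 * cos v.1.2) (v.1.1.2 * sin v.1.2) v.2.

Lemma continuous_polar_point : continuous polar_point.
Proof. by rewrite /polar_point /near_x /cis4; continuity. Qed.

End TorusMaps.

(** * Paths in the torus *)

Lemma cis4_eq (R : realType) (x y z t x' y' z' t' : R) : cis x = cis x' -> cis y = cis y' ->
  cis z = cis z' -> cis t = cis t' -> cis4 x y z t = cis4 x' y' z' t'.
Proof. by rewrite /cis4 => -> -> -> ->. Qed.

Ltac torus_eq := rewrite /torus_point /=; apply: cis4_eq;
  first [ congr cis; ring | rewrite -[RHS]cisD2pi; congr cis; ring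
        | rewrite -[LHS]cisD2pi; congr cis; ring ].

Section TorusPaths.
Context {R : realType}.
Variable eps : R.
Hypothesis heps : 0 < eps <= pi / 30.
Local Notation "p ~~ q" := (teq p q) (at level 70).

Definition o4 : R * R * R * R := (0, 0, 0, 0).
Definition e4 : R * R * R * R :=
  (- (pi / 2) + eps / Num.sqrt 2, pi / 2 - eps / Num.sqrt 2, 0, 0).

Lemma rho1E : rho1 eps = torus_point \o seg o4 e4.
Proof.
by apply/funext => s; rewrite /rho1 /= /torus_point /=; apply: cis4_eq; congr cis; ring.
Qed.

Lemma loop_xE : @loop_x R = torus_point \o seg o4 (2 * pi, 0, 0, 0).
Proof.
by apply/funext => s; rewrite /loop_x /= /torus_point /=; apply: cis4_eq; congr cis; ring.
Qed.

Lemma loop_yE : @loop_y R = torus_point \o seg o4 (0, 2 * pi, 0, 0).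
Proof.
by apply/funext => s; rewrite /loop_y /= /torus_point /=; apply: cis4_eq; congr cis; ring.
Qed.

Lemma e_zE : e_z eps = torus_point e4.
Proof. by rewrite /e_z rho1E /= seg1. Qed.

Lemma eps_div_sqrt2 : 0 < eps / Num.sqrt 2 <= eps.
Proof.
have s2 : 0 < Num.sqrt 2 :> R by rewrite sqrtr_gt0.
case/andP: heps => eps0 _; apply/andP; split; first by rewrite divr_gt0.
rewrite ler_pdivrMr // ler_peMr ?(ltW eps0) //.
have := @sqr_sqrtr R 2 (ler0n _ _); move: (Num.sqrt _) s2 => s s2 ss; nra.
Qed.

(** The rectangle has the segment [rho1] as a diagonal. Both coordinates keep distance at least
    [eps / sqrt 2] from the center (-pi/2, pi/2), so it touches the neighborhood of T_z only at the
    corner e_z of its boundary. *)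
Lemma rectangle_notin_Nbd_z (x y z t : R) :
  - (pi / 2) + eps / Num.sqrt 2 <= x <= 0 ->
  0 <= y <= pi / 2 - eps / Num.sqrt 2 -> ~ Nbd_z eps (cis4 x y z t).
Proof.
have pi2 := pi_ge2 R; have /andP[eta0 _] := eps_div_sqrt2.
move: (eps / _) eta0 (@notin_Nbd_z R eps heps x y z t) => eta eta0 h hx hy.
apply: h.
- rewrite (_ : sin x = - cos (x + pi / 2)) ?lerN2.
    by rewrite cos_le_norm ?ger0_norm; lra.
  by rewrite -sinNpihalfD; congr sin; ring.
- rewrite (_ : sin y = cos (pi / 2 - y)).
    by rewrite cos_le_norm ?ger0_norm; lra.
  by rewrite -cosBpihalf -cosN opprB.
Qed.

Context {Z : topologicalType} {dz dt : R} {F : T4 R -> Z}.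
Hypothesis cF : {within complement_region eps dz dt, continuous F}.

Lemma box_continuous (l h : R * R * R * R) (f : R * R * R * R -> T4 R) :
  continuous f ->
  (forall v, box l h v -> complement_region eps dz dt (f v)) ->
  {within box l h, continuous (F \o f)}.
Proof.
move=> cf lh; refine (@within_continuous_compose _ _ _ _ _ _ _ _ _ cF) => //.
exact: within_continuousT.
Qed.

(** Both surgery neighborhoods require |sin z| > cos eps > 0, and the push-off has sin z = sin dz >
    0; at z = 0 only the neighborhood of T_z remains to be avoided. *)
Lemma z0_region (x y t : R) : 0 < sin dz -> ~ Nbd_z eps (cis4 x y 0 t) ->
  complement_region eps dz dt (cis4 x y 0 t).
Proof.
have := cos_eps_gt0 heps; move=> c0 sdz nz; apply: complement_regionP => //.
- by rewrite sin0 => -[_]; lra.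
- by rewrite sin0 => -[_]; lra.
- by move=> [/cis_sin + _]; rewrite sin0 => sd0; rewrite -sd0 ltxx in sdz.
Qed.

(** The counterpart for the first copy. The neighborhoods of the three tori are invariant under
    translation in t, so this slice disposes of the push-off alone. *)
Lemma t0_region (x y z : R) : 0 < sin dt ->
  ~ Nbd_x eps (cis4 x y z 0) -> ~ Nbd_y eps (cis4 x y z 0) ->
  ~ Nbd_z eps (cis4 x y z 0) -> complement_region eps dz dt (cis4 x y z 0).
Proof.
move=> sdt nx ny nz; split => //; first by case.
move=> [[x' [y' /cis4_inj[_ _ _ /cis_sin sd0]]] _].
by rewrite -sd0 sin0 ltxx in sdt.
Qed.

Lemma based_teq (l : R -> T4 R) (o z0 : Z) (rho : tpath R o z0)
    (l0 : tpath R o o) (p : tpath R z0 z0) :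
  (forall s, 0 <= s <= 1 -> rho s = F (rho1 eps s)) ->
  (forall s, 0 <= s <= 1 -> l0 s = F (l s)) ->
  (forall s, 0 <= s <= 1 -> p s = F (based eps l s)) ->
  p ~~ tcat (tinv rho) (tcat l0 rho).
Proof.
move=> rE lE pE; apply: teq_ext => s s01; rewrite pE //= /based /path_cat /path_rev.
case: ifPn => s2; first by rewrite rE //; lra.
by case: ifPn => s3; rewrite ?rE ?lE //; lra.
Qed.

(** Three boxes in the slice z = 0 are used. The rectangle around [rho1] times the t-circle
    transports the t-loop from e to e_z; the flat two-tori in directions x, t and y, t make it
    commute at e with the coordinate loops. *)
Lemma t_loop_commutes (z0 : Z) (x y t : tpath R z0 z0) : 0 < sin dz ->
  (forall s, 0 <= s <= 1 -> x s = F (based eps (@loop_x R) s)) ->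
  (forall s, 0 <= s <= 1 -> y s = F (based eps (@loop_y R) s)) ->
  (forall s, 0 <= s <= 1 -> t s = F (torus_point
     (seg e4 (e4.1.1.1, e4.1.1.2, 0, 2 * pi) s))) ->
  intertwines x t t /\ intertwines y t t.
Proof.
move=> sdz xE yE tE.
have pi2 := pi_ge2 R; have /andP[eta0 etaeps] := eps_div_sqrt2.
have cos0 := cos_eps_gt0 heps.
have epi : eps / Num.sqrt 2 <= pi / 30 by apply: le_trans etaeps _; case/andP: heps.
have Fe : F (torus_point e4) = z0.
  by rewrite -(seg0 e4 (e4.1.1.1, e4.1.1.2, 0, 2 * pi)) -tE ?path0 // lexx ler01.
pose bx l h := box_continuous (l := l) (h := h) (@continuous_torus_point R).
have cR : {within box (e4.1.1.1, 0, 0, 0) (0, e4.1.1.2, 0, 2 * pi),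
    continuous (F \o @torus_point R)}.
  apply: bx => -[[[vx vy] vz] vt] [/= hx hy hz ht].
  rewrite /torus_point /= (_ : vz = 0); last lra.
  by apply: z0_region => //; apply: rectangle_notin_Nbd_z.
have cX : {within box o4 (2 * pi, 0, 0, 2 * pi), continuous (F \o @torus_point R)}.
  apply: bx => -[[[vx vy] vz] vt] [/= hx hy hz ht].
  rewrite /torus_point /= (_ : vz = 0); last lra.
  apply: z0_region => // /(Nbd_zE heps)[_].
  by rewrite (_ : vy = 0) ?sin0; lra.
have cY : {within box o4 (0, 2 * pi, 0, 2 * pi), continuous (F \o @torus_point R)}.
  apply: bx => -[[[vx vy] vz] vt] [/= hx hy hz ht].
  rewrite /torus_point /= (_ : vz = 0); last lra.
  apply: z0_region => // /(Nbd_zE heps)[].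
  by rewrite (_ : vx = 0) ?sin0; lra.
pose o := F (torus_point o4).
pose oT : R * R * R * R := (0, 0, 0, 2 * pi).
pose eT : R * R * R * R := (e4.1.1.1, e4.1.1.2, 0, 2 * pi).
have bR : let B := box (e4.1.1.1, 0, 0, 0) (0, e4.1.1.2, 0, 2 * pi) in
    [/\ B o4, B oT, B e4 & B eT] by split; split => /=; lra.
have bX : let B := box o4 (2 * pi, 0, 0, 2 * pi) in
    [/\ B o4, B oT, B (2 * pi, 0, 0, 0) & B (2 * pi, 0, 0, 2 * pi)].
  by split; split => /=; lra.
have bY : let B := box o4 (0, 2 * pi, 0, 2 * pi) in
    [/\ B o4, B oT, B (0, 2 * pi, 0, 0) & B (0, 2 * pi, 0, 2 * pi)].
  by split; split => /=; lra.
case: bR bX bY => R1 R2 R3 R4 [X1 X2 X3 X4] [Y1 Y2 Y3 Y4].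
have loop v : torus_point v = torus_point o4 -> (F \o @torus_point R) v = o.
  by move=> vo; rewrite /= vo.
pose rho : tpath R o z0 := seg_path cR R1 R3 erefl Fe.
pose x0 : tpath R o o := seg_path cX X1 X3 erefl (loop (2 * pi, 0, 0, 0) ltac:(torus_eq)).
pose y0 : tpath R o o := seg_path cY Y1 Y3 erefl (loop (0, 2 * pi, 0, 0) ltac:(torus_eq)).
pose t0 : tpath R o o := seg_path cX X1 X2 erefl (loop oT ltac:(torus_eq)).
have rhot : intertwines rho t0 t.
  apply: (box_square_teq cR R1 R2 R3 R4) => // s s01 /=.
  by congr F; torus_eq.
have xt : intertwines x0 t0 t0.
  apply: (box_square_teq cX X1 X2 X3 X4) => // s s01 /=.
    by congr F; torus_eq.
  by congr F; torus_eq.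
have yt : intertwines y0 t0 t0.
  apply: (box_square_teq cY Y1 Y2 Y3 Y4) => // s s01 /=.
    by congr F; torus_eq.
  by congr F; torus_eq.
have xE' : x ~~ tcat (tinv rho) (tcat x0 rho).
  by apply: based_teq xE => s s01; rewrite ?rho1E ?loop_xE.
have yE' : y ~~ tcat (tinv rho) (tcat y0 rho).
  by apply: based_teq yE => s s01; rewrite ?rho1E ?loop_yE.
split; rewrite /intertwines ?xE' ?yE'.
  by do 2 ?[apply: intertwines_tcat]; [exact: intertwines_tinv rhot|exact: xt|exact: rhot].
by do 2 ?[apply: intertwines_tcat]; [exact: intertwines_tinv rhot|exact: yt|exact: rhot].
Qed.
End TorusPaths.

(** * The relation at T_x *)

Section Quarter.
Context {R : realType}.
Implicit Types (eps a y z : R).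

Lemma sin_piquarter : sin (pi / 4) = cos (pi / 4) :> R.
Proof.
rewrite -cosBpihalf -cosN; congr cos; lra.
Qed.

Lemma sqr_cos_piquarter : cos (pi / 4) ^+ 2 = 1 / 2 :> R.
Proof. have := cos2Dsin2 (pi / 4 : R); rewrite sin_piquarter; lra. Qed.

Lemma cos_piquarter_gt0 : 0 < cos (pi / 4) :> R.
Proof. by apply: cos_gt0_pihalf; have := pi_ge2 R; lra. Qed.

Lemma cos_quarter a : `|a| <= pi / 4 -> cos (pi / 4) <= cos a.
Proof.
move=> ha; have := pi_ge2 R => pi2.
by rewrite leNgt -cos_norm ltr_cos ?in_itv /= ?normr_ge0 -?leNgt //; lra.
Qed.

Lemma cos_le_cos_outside eps a : 0 <= eps <= pi -> eps <= a <= 2 * pi - eps ->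
  cos a <= cos eps.
Proof.
move=> eps0 ha; case: (leP a pi) => api.
  by rewrite cos_le_norm ?ger0_norm //; lra.
rewrite (_ : cos a = cos (2 * pi - a)).
  by rewrite cos_le_norm ?ger0_norm //; lra.
by rewrite -[RHS]cosN opprB (mulr_natl pi 2) -(cosD2pi (a - _)) subrK.
Qed.

Lemma sin_ge_Ncos eps y : 0 <= eps <= pi -> eps <= `|y + pi / 2| <= 2 * pi - eps ->
  - cos eps <= sin y.
Proof.
move=> eps0 hy; rewrite (_ : sin y = - cos (y + pi / 2)).
  by rewrite lerN2 -cos_norm; exact: cos_le_cos_outside.
by rewrite cosDpihalf opprK.
Qed.

Lemma sin_le_cos eps z : 0 <= eps <= pi -> eps <= `|z - pi / 2| <= 2 * pi - eps ->
  sin z <= cos eps.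
Proof. by move=> eps0 hz; rewrite -cosBpihalf -cos_norm; exact: cos_le_cos_outside. Qed.

End Quarter.

Section SurgeryRelation.
Context {R : realType}.
Variable eps : R.
Hypothesis heps : 0 < eps <= pi / 30.
Local Notation "p ~~ q" := (teq p q) (at level 70).
Context {Z : topologicalType} {dz dt : R} {F : T4 R -> Z}.
Hypothesis cF : {within complement_region eps dz dt, continuous F}.
Hypothesis sdt : 0 < sin dt.
Local Notation Ft := (F \o @torus_point R).
Local Notation Fp := (F \o @polar_point R).

Let e0 : 0 <= eps <= pi.
Proof. by have := pi_ge2 R; case/andP: heps => ? ?; lra. Qed.

(** Each point must be clear of the hole in a single coordinate. The upper bound 2 pi - eps excludes
    the next translate of the hole, since the boxes reach across a full period; x = 0 excludes T_y
    and T_z. *)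
Lemma plane_continuous (l h : R * R * R * R) :
  l.2 = 0 -> h.2 = 0 -> l.1.1.1 = 0 -> h.1.1.1 = 0 ->
  (forall y z, l.1.1.2 <= y <= h.1.1.2 -> l.1.2 <= z <= h.1.2 ->
     eps <= `|y + pi / 2| <= 2 * pi - eps \/
     eps <= `|z - pi / 2| <= 2 * pi - eps) ->
  {within box l h, continuous Ft}.
Proof.
move=> l2 h2 l1 h1 lh; apply: (box_continuous cF (@continuous_torus_point R)).
move=> -[[[vx vy] vz] vt] []; rewrite l2 h2 l1 h1 /= => hx hy hz ht.
rewrite /torus_point /= (_ : vt = 0); last lra.
rewrite (_ : vx = 0); last lra.
have c0 := cos_eps_gt0 heps; apply: (t0_region sdt).
- move=> /(Nbd_xE heps)[]; case: (lh _ _ hy hz).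
  + by move=> /(sin_ge_Ncos e0); lra.
  + by move=> /(sin_le_cos e0); lra.
- by move=> /(Nbd_yE heps)[]; rewrite sin0; lra.
- by move=> /(Nbd_zE heps)[]; rewrite sin0; lra.
Qed.

(* The circle of this radius passes through the corners of the square of
   half-side [eps], so its quarters lie in half-planes missing the [eps]-disk. *)
Definition corner_radius := eps / cos (pi / 4).

Lemma corner_radiusE : corner_radius * cos (pi / 4) = eps.
Proof. by rewrite /corner_radius mulfVK // gt_eqF // cos_piquarter_gt0. Qed.

Lemma corner_radius_bounds : eps <= corner_radius <= pi / 15.
Proof.
have pi2 := pi_ge2 R; have := corner_radiusE.
have := @sqr_cos_piquarter R; have := @cos_piquarter_gt0 R.
move: corner_radius (cos (pi / 4)) heps => r c /andP[? ?] c1 c2 rc.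
apply/andP; split; nra.
Qed.

(** The outer radius is at most pi/15, which gives sin z >= 0 and sin y <= 0 and so excludes T_y and
    T_z. The angles range over [-pi/4, 2 pi] so that one box holds both the outer circle read from
    its corner at -pi/4 and the meridian read from 0. *)
Lemma polar_continuous :
  {within box (0, eps, - (pi / 4), 0) (2 * pi, corner_radius, 2 * pi, 0),
    continuous Fp}.
Proof.
have pi2 := pi_ge2 R; have hr := corner_radius_bounds; case/andP: heps => eps0 epspi.
apply: (box_continuous cF (@continuous_polar_point R)).
move=> -[[[vx r] th] vt] [/= hx hy hz ht].
have [cb sb] : `|r * cos th| <= r /\ `|r * sin th| <= r.
  rewrite !normrM ger0_norm; last lra.
  by split; rewrite ler_piMr //; [lra|exact: cos_max|lra|exact: sin_max].
rewrite /polar_point /= (_ : vt = 0); last lra.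
have c0 := cos_eps_gt0 heps; apply: (t0_region sdt).
- apply: (near_x_notin_Nbd_x heps); [|lra|lra].
  by rewrite !exprMn -mulrDr cos2Dsin2 mulr1; nra.
- move=> /(Nbd_yE heps)[] _; rewrite sin_pihalfD.
  have : 0 <= cos (r * sin th).
    by apply: cos_ge0_pihalf; rewrite -ler_norml; lra.
  lra.
- move=> /(Nbd_zE heps)[] _; rewrite sinNpihalfD.
  have : 0 <= cos (r * cos th).
    by apply: cos_ge0_pihalf; rewrite -ler_norml; lra.
  lra.
Qed.

Definition arc_point (th : R) : R * R * R * R :=
  (0, - (pi / 2) + corner_radius * cos th, pi / 2 + corner_radius * sin th, 0).

Lemma polar_arc_point th : polar_point (0, corner_radius, th, 0) =
  torus_point (arc_point th).
Proof. by []. Qed.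

(** Three sides are straight in cartesian coordinates; the arc is straight only in polar ones.
    Because the strip is convex, it is enough that the cartesian lift of the arc stays inside it. *)
Lemma strip_square_teq (l h C C' K K' : R * R * R * R) (phi phi' : R)
    (o n n' : Z) (L : tpath R o o) (k' : tpath R o n') (k : tpath R o n)
    (A : tpath R n n') :
  {within box l h, continuous Ft} ->
  box l h C -> box l h C' -> box l h K -> box l h K' ->
  phi' = phi + pi / 2 -> arc_point phi = K -> arc_point phi' = K' ->
  (forall s, 0 <= s <= 1 -> box l h (arc_point (phi + s * (pi / 2)))) ->
  (forall s, 0 <= s <= 1 -> L s = Ft (seg C C' s)) ->
  (forall s, 0 <= s <= 1 -> k' s = Ft (seg C' K' s)) ->
  (forall s, 0 <= s <= 1 -> k s = Ft (seg C K s)) ->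
  (forall s, 0 <= s <= 1 ->
     A s = Fp (seg (0, corner_radius, phi, 0) (0, corner_radius, phi', 0) s)) ->
  tcat L k' ~~ tcat k A.
Proof.
move=> clh lC lC' lK lK' -> aK aK' larc LE kE' kE AE.
apply: (square_teq (a := seg C C') (b := seg C' K') (c := seg C K)
  (d := fun s => arc_point (phi + s * (pi / 2))) (@convex_box R l h) clh);
  rewrite ?seg0 ?seg1 ?mul0r ?mul1r ?addr0 //; try exact: path_in_seg.
- by split => //; apply: within_continuousT; rewrite /arc_point; continuity.
- move=> s s01; rewrite AE //=; congr F; rewrite -polar_arc_point /seg /=.
  by congr (polar_point (_, _, _, _)); ring.
Qed.

(** For angles in [-pi/4, pi/4] the cosine is at least cos(pi/4), so the arc stays beyond the line
    at distance eps from the center. The other three quarters are obtained from this one by quarter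
    turns. *)
Lemma quarter_arc s : 0 <= s <= 1 ->
  let a := s * (pi / 2) - pi / 4 in
  eps <= corner_radius * cos a <= pi / 15 /\
  - (pi / 15) <= corner_radius * sin a <= pi / 15.
Proof.
move=> s01 a; have pi2 := pi_ge2 R; have /andP[r1 r2] := corner_radius_bounds.
have ha : `|a| <= pi / 4 by rewrite ler_norml /a; apply/andP; split; nra.
have := cos_quarter ha; have := corner_radiusE.
have := cos_le1 a; have := sin_max a; rewrite ler_norml.
move: (cos a) (sin a) (cos (pi / 4)) corner_radius r1 r2 => ca sa c r r1 r2.
case/andP: heps => ? ? /andP[? ?] ? rc ?.
by split; apply/andP; split; nra.
Qed.

Let pt (y z : R) : R * R * R * R := (0, y, z, 0).

Let box_pt (y0 z0 y1 z1 y z : R) : y0 <= y <= y1 -> z0 <= z <= z1 ->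
  box (pt y0 z0) (pt y1 z1) (pt y z).
Proof. by move=> hy hz; split; rewrite /= ?lexx. Qed.

Lemma arcs_in_strips (s : R) : 0 <= s <= 1 ->
  [/\ box (pt (- (pi / 2) + eps) 0) (pt 0 (2 * pi))
        (arc_point (- (pi / 4) + s * (pi / 2))),
      box (pt (- (2 * pi)) (pi / 2 + eps)) (pt 0 (2 * pi))
        (arc_point (pi / 4 + s * (pi / 2))),
      box (pt (- (2 * pi)) 0) (pt (- (pi / 2) - eps) (2 * pi))
        (arc_point (pi / 4 + pi / 2 + s * (pi / 2)))
    & box (pt (- (2 * pi)) 0) (pt 0 (pi / 2 - eps))
        (arc_point (pi / 4 + pi / 2 + pi / 2 + s * (pi / 2)))].
Proof.
move=> s01; have [] := quarter_arc s01; set a := _ * (pi / 2) - pi / 4.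
rewrite (_ : - (pi / 4) + _ = a); last by rewrite /a; lra.
rewrite (_ : pi / 4 + s * _ = a + pi / 2); last by rewrite /a; lra.
rewrite (_ : pi / 4 + pi / 2 + s * _ = a + pi / 2 + pi / 2); last by rewrite /a; lra.
rewrite (_ : pi / 4 + pi / 2 + pi / 2 + s * _ = a + pi / 2 + pi / 2 + pi / 2);
  last by rewrite /a; lra.
rewrite /arc_point !(cosDpihalf, sinDpihalf) !opprK !mulrN.
have pi2 := pi_ge2 R; case/andP: heps.
move: (_ * cos a) (_ * sin a) => c d ? ? ? ?.
by split; apply: box_pt; lra.
Qed.

Lemma arc_corners :
  [/\ arc_point (- (pi / 4)) = pt (- (pi / 2) + eps) (pi / 2 - eps),
      arc_point (pi / 4) = pt (- (pi / 2) + eps) (pi / 2 + eps),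
      arc_point (pi / 4 + pi / 2) = pt (- (pi / 2) - eps) (pi / 2 + eps),
      arc_point (pi / 4 + pi / 2 + pi / 2) = pt (- (pi / 2) - eps) (pi / 2 - eps)
    & arc_point (pi / 4 + pi / 2 + pi / 2 + pi / 2) =
        pt (- (pi / 2) + eps) (pi / 2 - eps)].
Proof.
by split; rewrite /arc_point ?(cosDpihalf, sinDpihalf) ?cosN ?sinN sin_piquarter
  ?opprK ?mulrN corner_radiusE.
Qed.

Let polar_box := box (0, eps, - (pi / 4), 0) (2 * pi, corner_radius, 2 * pi, 0).
Let circle_pt (r th : R) : R * R * R * R := (0, r, th, 0).

Let polar_boxP r th : eps <= r <= corner_radius -> - (pi / 4) <= th <= 2 * pi ->
  polar_box (circle_pt r th).
Proof.
move=> hr hth; split; rewrite /= ?lexx //; have := pi_ge2 R; lra.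
Qed.

(** The annulus unrolls to a box in polar coordinates, where a broken line deforms to the segment
    with the same ends. This is how the quarter arcs add up to a full circle. *)
Lemma arcs_teq (n0 n1 n2 n3 n4 : Z) (A0 : tpath R n0 n1) (A1 : tpath R n1 n2)
    (A2 : tpath R n2 n3) (A3 : tpath R n3 n4) (A : tpath R n0 n4)
    (v0 v1 v2 v3 v4 : R * R * R * R) :
  polar_box v0 -> polar_box v1 -> polar_box v2 -> polar_box v3 -> polar_box v4 ->
  (forall s, 0 <= s <= 1 -> A0 s = Fp (seg v0 v1 s)) ->
  (forall s, 0 <= s <= 1 -> A1 s = Fp (seg v1 v2 s)) ->
  (forall s, 0 <= s <= 1 -> A2 s = Fp (seg v2 v3 s)) ->
  (forall s, 0 <= s <= 1 -> A3 s = Fp (seg v3 v4 s)) ->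
  (forall s, 0 <= s <= 1 -> A s = Fp (seg v0 v4 s)) ->
  tcat A0 (tcat A1 (tcat A2 A3)) ~~ A.
Proof.
move=> b0 b1 b2 b3 b4 E0 E1 E2 E3 E4.
have I3 : path_in polar_box (path_cat (seg v2 v3) (seg v3 v4)).
  by apply: path_in_cat; rewrite ?seg0 ?seg1 //; exact: path_in_seg.
have I2 : path_in polar_box
    (path_cat (seg v1 v2) (path_cat (seg v2 v3) (seg v3 v4))).
  by apply: path_in_cat; rewrite ?path_cat0 ?seg0 ?seg1 //; exact: path_in_seg.
have I1 : path_in polar_box (path_cat (seg v0 v1)
    (path_cat (seg v1 v2) (path_cat (seg v2 v3) (seg v3 v4)))).
  by apply: path_in_cat; rewrite ?path_cat0 ?seg0 ?seg1 //; exact: path_in_seg.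
have := convex_homotopic (@convex_box R _ _) I1 (path_in_seg b0 b4).
rewrite !(path_cat0, path_cat1, seg0, seg1) => /(_ erefl erefl).
move=> /(path_homotopic_map polar_continuous).
apply: path_homotopic_ext => s s01; rewrite ?E4 //= /path_cat.
case: ifPn => h1; first by rewrite E0 //; lra.
case: ifPn => h2; first by rewrite E1 //; lra.
by case: ifPn => h3; rewrite ?E2 ?E3 //; lra.
Qed.

(** In the universal cover of the yz-torus the square with corners (0, 0), (0, 2 pi), (-2 pi, 2 pi),
    (-2 pi, 0) surrounds the hole at (-pi/2, pi/2), and its boundary reads [w], inverse of [y],
    inverse of [w], [y]. Spokes [k0], ..., [k3] join its corners to those of the small square around
    the hole; each strip [B0], ..., [B3] contains one edge, two spokes and one quarter arc. *)
Lemma strips_teq (o : Z) (y w : tpath R o o) (n0 : Z) :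
  (forall s, 0 <= s <= 1 -> y s = Ft (seg (pt 0 0) (pt (2 * pi) 0) s)) ->
  (forall s, 0 <= s <= 1 -> w s = Ft (seg (pt 0 0) (pt 0 (2 * pi)) s)) ->
  n0 = Ft (pt (- (pi / 2) + eps) (pi / 2 - eps)) ->
  exists (k : tpath R o n0) (A : tpath R n0 n0),
  [/\ forall s, 0 <= s <= 1 ->
        k s = Ft (seg (pt 0 0) (pt (- (pi / 2) + eps) (pi / 2 - eps)) s),
      forall s, 0 <= s <= 1 -> A s = Fp (seg (0, corner_radius, - (pi / 4), 0)
         (0, corner_radius, pi / 4 + pi / 2 + pi / 2 + pi / 2, 0) s)
    & tcat (tcat w (tcat (tinv y) (tcat (tinv w) y))) k ~~ tcat k A].
Proof.
move=> yE wE n0E; have pi2 := pi_ge2 R; case/andP: heps => eps0 epspi.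
have Fo : Ft (pt 0 0) = o.
  by rewrite -(path0 y) yE ?seg0 ?lexx ?ler01.
have [K0 K1 K2 K3 K4] := arc_corners.
pose B0 := box (pt (- (pi / 2) + eps) 0) (pt 0 (2 * pi)).
pose B1 := box (pt (- (2 * pi)) (pi / 2 + eps)) (pt 0 (2 * pi)).
pose B2 := box (pt (- (2 * pi)) 0) (pt (- (pi / 2) - eps) (2 * pi)).
pose B3 := box (pt (- (2 * pi)) 0) (pt 0 (pi / 2 - eps)).
have cS0 : {within B0, continuous Ft}.
  apply: plane_continuous => //= u v hu hv; left.
  by rewrite ger0_norm; lra.
have cS1 : {within B1, continuous Ft}.
  apply: plane_continuous => //= u v hu hv; right.
  by rewrite ger0_norm; lra.
have cS2 : {within B2, continuous Ft}.
  apply: plane_continuous => //= u v hu hv; left.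
  by rewrite ler0_norm; lra.
have cS3 : {within B3, continuous Ft}.
  apply: plane_continuous => //= u v hu hv; right.
  by rewrite ler0_norm; lra.
have tF v : torus_point v = torus_point (pt 0 0) -> Ft v = o.
  by move=> vo; rewrite /= vo.
pose n1 := Ft (pt (- (pi / 2) + eps) (pi / 2 + eps)).
pose n2 := Ft (pt (- (pi / 2) - eps) (pi / 2 + eps)).
pose n3 := Ft (pt (- (pi / 2) - eps) (pi / 2 - eps)).
have b0 : [/\ B0 (pt 0 0), B0 (pt 0 (2 * pi)),
    B0 (pt (- (pi / 2) + eps) (pi / 2 - eps))
  & B0 (pt (- (pi / 2) + eps) (pi / 2 + eps))] by split; apply: box_pt; lra.
have b1 : [/\ B1 (pt 0 (2 * pi)), B1 (pt (- (2 * pi)) (2 * pi)),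
    B1 (pt (- (pi / 2) + eps) (pi / 2 + eps))
  & B1 (pt (- (pi / 2) - eps) (pi / 2 + eps))] by split; apply: box_pt; lra.
have b2 : [/\ B2 (pt (- (2 * pi)) (2 * pi)), B2 (pt (- (2 * pi)) 0),
    B2 (pt (- (pi / 2) - eps) (pi / 2 + eps))
  & B2 (pt (- (pi / 2) - eps) (pi / 2 - eps))] by split; apply: box_pt; lra.
have b3 : [/\ B3 (pt (- (2 * pi)) 0), B3 (pt 0 0),
    B3 (pt (- (pi / 2) - eps) (pi / 2 - eps))
  & B3 (pt (- (pi / 2) + eps) (pi / 2 - eps))] by split; apply: box_pt; lra.
case: b0 b1 b2 b3 => b01 b02 b03 b04 [b11 b12 b13 b14] [b21 b22 b23 b24]
  [b31 b32 b33 b34].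
have [[p0 p1 p2] [p3 p4]] : [/\ polar_box (circle_pt corner_radius (- (pi / 4))),
    polar_box (circle_pt corner_radius (pi / 4))
  & polar_box (circle_pt corner_radius (pi / 4 + pi / 2))] /\
  polar_box (circle_pt corner_radius (pi / 4 + pi / 2 + pi / 2)) /\
  polar_box (circle_pt corner_radius (pi / 4 + pi / 2 + pi / 2 + pi / 2)).
  by have [? ?] := andP corner_radius_bounds;
    split; split; apply: polar_boxP; lra.
have cP := polar_continuous.
have FpK th v : arc_point th = v -> Fp (circle_pt corner_radius th) = Ft v.
  by move=> <-.
have [A0 A0E] := seg_path_exists cP p0 p1 (etrans (FpK _ _ K0) (esym n0E))
  (FpK _ _ K1 : _ = n1).
have [A1 A1E] := seg_path_exists cP p1 p2 (FpK _ _ K1 : _ = n1)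
  (FpK _ _ K2 : _ = n2).
have [A2 A2E] := seg_path_exists cP p2 p3 (FpK _ _ K2 : _ = n2)
  (FpK _ _ K3 : _ = n3).
have [A3 A3E] := seg_path_exists cP p3 p4 (FpK _ _ K3 : _ = n3)
  (etrans (FpK _ _ K4) (esym n0E)).
have [A AE] := seg_path_exists cP p0 p4 (etrans (FpK _ _ K0) (esym n0E))
  (etrans (FpK _ _ K4) (esym n0E)).
have [k0 k0E] := seg_path_exists cS0 b01 b03 Fo (esym n0E).
have [k1 k1E] := seg_path_exists cS0 b02 b04 (tF (pt 0 (2 * pi)) ltac:(torus_eq)) (erefl n1).
have [k2 k2E] := seg_path_exists cS1 b12 b14
  (tF (pt (- (2 * pi)) (2 * pi)) ltac:(torus_eq)) (erefl n2).
have [k3 k3E] := seg_path_exists cS2 b22 b24 (tF (pt (- (2 * pi)) 0) ltac:(torus_eq)) (erefl n3).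
exists k0, A; split => //.
have AA := arcs_teq p0 p1 p2 p3 p4 A0E A1E A2E A3E AE.
have [S0 S1 S2 S3] : [/\
    forall s, 0 <= s <= 1 -> B0 (arc_point (- (pi / 4) + s * (pi / 2))),
    forall s, 0 <= s <= 1 -> B1 (arc_point (pi / 4 + s * (pi / 2))),
    forall s, 0 <= s <= 1 -> B2 (arc_point (pi / 4 + pi / 2 + s * (pi / 2)))
  & forall s, 0 <= s <= 1 ->
      B3 (arc_point (pi / 4 + pi / 2 + pi / 2 + s * (pi / 2)))].
  by split=> s /arcs_in_strips[].
have s0 : tcat w k1 ~~ tcat k0 A0.
  apply: (strip_square_teq cS0 b01 b02 b03 b04 _ K0 K1 S0 wE k1E k0E A0E).
  by lra.
have s1 : tcat (tinv y) k2 ~~ tcat k1 A1.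
  apply: (strip_square_teq cS1 b11 b12 b13 b14 erefl K1 K2 S1 _ k2E k1E A1E).
  move=> s s01; rewrite /= /path_rev yE /=; last by lra.
  by congr F; torus_eq.
have s2 : tcat (tinv w) k3 ~~ tcat k2 A2.
  apply: (strip_square_teq cS2 b21 b22 b23 b24 erefl K2 K3 S2 _ k3E k2E A2E).
  move=> s s01; rewrite /= /path_rev wE /=; last by lra.
  by congr F; torus_eq.
have s3 : tcat y k0 ~~ tcat k3 A3.
  apply: (strip_square_teq cS3 b31 b32 b33 b34 erefl K3 K4 S3 _ k0E k3E A3E).
  move=> s s01; rewrite yE //=.
  by congr F; torus_eq.
(* The word is treated from its last edge: an edge and the spoke after it are traded for the spoke
   at the start of the edge and an arc, until only [k0] stands in front. *)
rewrite -AA !teq_assoc s3 -(teq_assoc _ k3) s2 teq_assoc -(teq_assoc _ k2) s1.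
by rewrite !teq_assoc -(teq_assoc _ k1) s0 !teq_assoc.
Qed.

Local Notation e4 := (e4 eps).
Let eZ : R * R * R * R := (e4.1.1.1, e4.1.1.2, 2 * pi, 0).
Let rect_box := box (e4.1.1.1, 0, 0, 0) (0, e4.1.1.2, 2 * pi, 0).

(** On the rectangle sin y >= 0 and sin x <= 0, whereas the neighborhoods of T_x and T_y require sin
    y < 0 and sin x > 0 respectively; hence the whole z-circle over it is available. *)
Lemma rectangle_continuous : {within rect_box, continuous Ft}.
Proof.
have pi2 := pi_ge2 R; have c0 := cos_eps_gt0 heps; have h := eps_div_sqrt2 heps.
apply: (box_continuous cF (@continuous_torus_point R)).
move=> -[[[vx vy] vz] vt] [/= hx hy hz ht].
rewrite /torus_point /= (_ : vt = 0); last lra.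
apply: (t0_region sdt).
- move=> /(Nbd_xE heps)[+ _].
  have : 0 <= sin vy.
    by apply: sin_ge0_pi; move: (eps / _) h hy => eta ? ?; lra.
  lra.
- move=> /(Nbd_yE heps)[+ _].
  have : 0 <= sin (- vx).
    apply: sin_ge0_pi; move: (eps / _) h hx => eta ? ?; lra.
  by rewrite sinN; lra.
- exact: rectangle_notin_Nbd_z.
Qed.

Let push_box := box (0, - (pi / 2) + eps, 0, 0) (2 * pi, 0, pi / 2, 0).

(** This box carries the x-circle from the origin to the corner, nearest to e, of the square around
    T_x. The y-coordinate avoids T_x, and the signs of sin z and sin y exclude T_y and T_z. *)
Lemma push_continuous : {within push_box, continuous Ft}.
Proof.
have pi2 := pi_ge2 R; have c0 := cos_eps_gt0 heps; case/andP: (heps) => eps0 epspi.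
apply: (box_continuous cF (@continuous_torus_point R)).
move=> -[[[vx vy] vz] vt] [/= hx hy hz ht].
rewrite /torus_point /= (_ : vt = 0); last lra.
apply: (t0_region sdt).
- move=> /(Nbd_xE heps)[+ _].
  have : - cos eps <= sin vy by apply: (sin_ge_Ncos e0); rewrite ger0_norm; lra.
  lra.
- move=> /(Nbd_yE heps)[_ +].
  have : 0 <= sin vz by apply: sin_ge0_pi; lra.
  lra.
- move=> /(Nbd_zE heps)[_ +].
  have : 0 <= sin (- vy) by apply: sin_ge0_pi; lra.
  by rewrite sinN; lra.
Qed.

Lemma polar_pointD2pi (x r th t : R) :
  polar_point (x, r, th + 2 * pi, t) = polar_point (x, r, th, t).
Proof.
by rewrite /polar_point /= (mulr_natl pi 2) (cosD2pi th) (sinD2pi th).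
Qed.

Lemma polar_corner (x : R) : polar_point (x, corner_radius, - (pi / 4), 0) =
  torus_point (x, - (pi / 2) + eps, pi / 2 - eps, 0).
Proof.
have [+ _ _ _ _] := arc_corners; rewrite /arc_point /pt => -[e1 e2].
by rewrite /polar_point /near_x /torus_point /= e1 e2.
Qed.

(** The x-loop is pushed along [k] to a corner of the square around T_x and along [g] to the
    boundary torus. There the surgery exchanges it for the meridian, which expands along [g] to the
    outer circle; the strips read that circle as a commutator at e. Finally [rho] moves everything
    to e_z. *)
Lemma x_loop_word (z0 : Z) (x y z : tpath R z0 z0) :
  (forall s, 0 <= s <= 1 -> x s = F (based eps (@loop_x R) s)) ->
  (forall s, 0 <= s <= 1 -> y s = F (based eps (@loop_y R) s)) ->
  (forall s, 0 <= s <= 1 -> z s = Ft (seg e4 eZ s)) ->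
  path_homotopic setT (F \o bloop_x eps) (F \o mu_x eps) ->
  x ~~ tcat z (tcat (tinv y) (tcat (tinv z) y)).
Proof.
move=> xE yE zE surg; have pi2 := pi_ge2 R; case/andP: heps => eps0 epspi.
have Fe : Ft e4 = z0 by rewrite -(path0 z) zE ?seg0 ?lexx ?ler01.
pose o := Ft (pt 0 0).
have tF v : torus_point v = torus_point (pt 0 0) -> Ft v = o.
  by move=> vo; rewrite /= vo.
pose K := pt (- (pi / 2) + eps) (pi / 2 - eps).
pose xK : R * R * R * R := (2 * pi, - (pi / 2) + eps, pi / 2 - eps, 0).
pose xO : R * R * R * R := (2 * pi, 0, 0, 0).
pose n0 := Ft K.
have [b1 b2 b3 b4] : [/\ rect_box (pt 0 0), rect_box (pt 0 (2 * pi)), rect_box e4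
    & rect_box eZ].
  have := eps_div_sqrt2 heps; rewrite /rect_box /eZ /e4 /=.
  by move: (eps / _) => eta ?; split; split => /=; lra.
have [q1 q2 q3 q4] : [/\ push_box (pt 0 0), push_box K, push_box xO
    & push_box xK] by split; split => /=; lra.
have cR := rectangle_continuous; have cQ := push_continuous.
have cY : {within box (pt 0 0) (pt (2 * pi) 0), continuous Ft}.
  apply: plane_continuous => //= u v hu hv; right.
  by rewrite (_ : v = 0) ?sub0r ?normrN ?ger0_norm; lra.
have [y1 y2] : box (pt 0 0) (pt (2 * pi) 0) (pt 0 0) /\
    box (pt 0 0) (pt (2 * pi) 0) (pt (2 * pi) 0) by split; apply: box_pt; lra.
have [rho rhoE] := seg_path_exists cR b1 b3 (erefl o) Fe.
have [w wE] := seg_path_exists cR b1 b2 (erefl o) (tF (pt 0 (2 * pi)) ltac:(torus_eq)).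
have [y0 y0E] := seg_path_exists cY y1 y2 (erefl o) (tF (pt (2 * pi) 0) ltac:(torus_eq)).
have [x0 x0E] := seg_path_exists cQ q1 q3 (erefl o) (tF xO ltac:(torus_eq)).
have rhow : intertwines rho w z.
  apply: (box_square_teq cR b1 b2 b3 b4 wE _ rhoE zE) => s s01; rewrite rhoE //=.
  by congr F; torus_eq.
have [k [A [kE AE wordA]]] := strips_teq y0E wE (erefl n0).
have cP := polar_continuous.
have [r1 r2] := andP corner_radius_bounds.
pose u4 := circle_pt corner_radius (pi / 4 + pi / 2 + pi / 2 + pi / 2).
have [[p0 p1] [p4 p5]] : (polar_box (circle_pt corner_radius (- (pi / 4))) /\
    polar_box (circle_pt eps 0)) /\
    polar_box u4 /\ polar_box (circle_pt eps (2 * pi)).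
  by split; split; apply: polar_boxP; lra.
have [p2 p3] : polar_box (2 * pi, corner_radius, - (pi / 4), 0) /\
    polar_box (2 * pi, eps, 0, 0) by split; split => /=; lra.
pose m := Fp (circle_pt eps 0).
have F2pi : Fp (2 * pi, eps, 0, 0) = m.
  by congr F; rewrite /polar_point /near_x /=; torus_eq.
(* [g] leads from angle -pi/4 on the outer circle to angle 0 on the circle of radius eps, where
   [bloop_x] and [mu_x] start. *)
have [g gE] := seg_path_exists cP p0 p1 (congr1 F (polar_corner 0) : _ = n0)
  (erefl m).
have K2pi : Fp (2 * pi, corner_radius, - (pi / 4), 0) = n0.
  by rewrite /= polar_corner; congr F; torus_eq.
have [x1 x1E] := seg_path_exists cP p0 p2 (congr1 F (polar_corner 0) : _ = n0)
  K2pi.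
have [b bE] := seg_path_exists cP p1 p3 (erefl m) F2pi.
have m2pi : Fp (circle_pt eps (2 * pi)) = m.
  by rewrite /m /= -(polar_pointD2pi 0 eps 0 0) add0r.
have [mu muE] := seg_path_exists cP p1 p5 (erefl m) m2pi.
have xk : tcat x0 k ~~ tcat k x1.
  apply: (box_square_teq cQ q1 q3 q2 q4 x0E _ kE) => s s01.
    by rewrite kE //=; congr F; torus_eq.
  rewrite x1E //=; congr F.
  rewrite (_ : seg _ _ s = (2 * pi * s, corner_radius, - (pi / 4), 0)).
    by rewrite polar_corner; torus_eq.
  by rewrite /seg /=; congr (_, _, _, _); ring.
have xg : tcat x1 g ~~ tcat g b.
  apply: (box_square_teq cP p0 p2 p1 p3 x1E _ gE bE) => s s01.
  rewrite gE //=; congr F; rewrite /polar_point /near_x /=.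
  by torus_eq.
(* The far side of this square runs from angle 7 pi/4 to 2 pi; it is [g] again, after a turn by 2
   pi. *)
have Ag : tcat A g ~~ tcat g mu.
  apply: (box_square_teq cP p0 p4 p1 p5 AE _ gE muE) => s s01.
  rewrite gE //=; congr F; rewrite -polar_pointD2pi.
  by congr polar_point; rewrite /seg /=; congr (_, _, _, _); field.
have bmu : b ~~ mu.
  apply: path_homotopic_ext surg => s s01.
    rewrite bE //=; congr F; rewrite /bloop_x.
    rewrite (_ : seg _ _ s = (2 * pi * s, eps, 0, 0)).
      by rewrite /polar_point /= cos0 sin0 mulr1 mulr0.
    by rewrite /seg /=; congr (_, _, _, _); ring.
  rewrite muE //=; congr F; rewrite /mu_x.
  rewrite (_ : seg _ _ s = (0, eps, 2 * pi * s, 0)) //.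
  by rewrite /seg /=; congr (_, _, _, _); ring.
have x0word : x0 ~~ tcat w (tcat (tinv y0) (tcat (tinv w) y0)).
  apply: (tcat_injr (r := tcat k g)).
  by rewrite -!(teq_assoc _ k) xk wordA !(teq_assoc k) xg Ag bmu.
have xE' : x ~~ tcat (tinv rho) (tcat x0 rho).
  by apply: based_teq xE => s s01; rewrite ?rho1E ?loop_xE ?rhoE ?x0E.
have yE' : y ~~ tcat (tinv rho) (tcat y0 rho).
  by apply: based_teq yE => s s01; rewrite ?rho1E ?loop_yE ?rhoE ?y0E.
have rhoy : intertwines rho y0 y by rewrite /intertwines yE' tcat_tinvK.
rewrite xE' x0word; apply: intertwines_conj.
apply: intertwines_mul => //; apply: intertwines_mul; first exact: intertwines_inv.
by apply: intertwines_mul => //; exact: intertwines_inv.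
Qed.

End SurgeryRelation.

(** * Radial retraction *)

Section RadialRetraction.
Context {R : realType} {S P : topologicalType}.
Implicit Types w : R * R.

Definition plane_norm w := Num.sqrt (w.1 ^+ 2 + w.2 ^+ 2).

Definition radial w : R * R := (w.1 / plane_norm w, w.2 / plane_norm w).

Lemma plane_norm_gt0 w : w <> (0, 0) -> 0 < plane_norm w.
Proof.
move=> w0; rewrite sqrtr_gt0 lt_neqAle eq_sym addr_ge0 ?sqr_ge0 // andbT.
rewrite paddr_eq0 ?sqr_ge0 // !sqrf_eq0; apply/negP => /andP[/eqP w1 /eqP w2].
by apply: w0; rewrite [w]surjective_pairing w1 w2.
Qed.

Lemma radial_circle w : w <> (0, 0) -> circle (radial w).
Proof.
move=> /plane_norm_gt0 n0; rewrite /circle /= !expr_div_n -mulrDl.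
rewrite /plane_norm sqr_sqrtr ?addr_ge0 ?sqr_ge0 // divff //.
by move: n0; rewrite sqrtr_gt0 => /gt_eqF ->.
Qed.

Lemma radial_id w : circle w -> radial w = w.
Proof.
rewrite /circle /radial /plane_norm /= => ->.
by rewrite sqrtr1 !divr1 -surjective_pairing.
Qed.

Lemma continuous_radial w : w <> (0, 0) -> {for w, continuous radial}.
Proof.
move=> w0; have n0 := plane_norm_gt0 w0.
have cn : plane_norm v @[v --> w] --> plane_norm w.
  have cs : continuous (fun v : R * R => v.1 * v.1 + v.2 * v.2) by continuity.
  exact: (continuous_comp (cs w) (@sqrt_continuous R _)).
have cV : (plane_norm v)^-1 @[v --> w] --> (plane_norm w)^-1.
  by apply: cvgV => //; rewrite gt_eqF.
have h1 : v.1 / plane_norm v @[v --> w] --> w.1 / plane_norm w.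
  have c1 : continuous (fun v : R * R => v.1) by continuity.
  by apply: cvgM cV; exact: c1.
have h2 : v.2 / plane_norm v @[v --> w] --> w.2 / plane_norm w.
  have c2 : continuous (fun v : R * R => v.2) by continuity.
  by apply: cvgM cV; exact: c2.
exact: cvg_pair h1 h2.
Qed.

Lemma compact_disk : compact (@disk R).
Proof.
have cI : compact ([set` `[-1, 1]] `*` [set` `[-1, 1]] : set (R * R)).
  by apply: compact_setX; exact: segment_compact.
apply: subclosed_compact cI _.
- have cf : continuous (fun w : R * R => w.1 * w.1 + w.2 * w.2) by continuity.
  exact: ((continuous_closedP _).1 cf _ (@closed_le R 1)).
- move=> w; rewrite /disk /= => hw; split => /=; rewrite in_itv /=; nra.
Qed.

(** Inside the disk bundle each disk is pushed radially onto its boundary circle, and outside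
    nothing moves. The two formulas agree on the circle bundle, so they paste once both pieces are
    closed. *)
Lemma radial_retraction (hP : S * (R * R) -> P) (g : P -> S * (R * R)) :
  compact [set: S] -> hausdorff_space P ->
  {within setT `*` disk, continuous hP} ->
  {within hP @` (setT `*` disk), continuous g} ->
  (forall a, (setT `*` disk) a -> g (hP a) = a) ->
  open (Nbd_Sigma hP) ->
  exists r : P -> P,
  [/\ {within ~` (hP @` (setT `*` [set (0, 0)])), continuous r},
      forall p, ~ (hP @` (setT `*` [set (0, 0)])) p -> ~ Nbd_Sigma hP (r p)
    & forall p, ~ Nbd_Sigma hP p -> r p = p].
Proof.
move=> cS hausP chP cg gK oN.
have disk_circle w : circle w -> disk w by rewrite /disk /circle /= => ->.
have disk_open w : open_disk w -> disk w by rewrite /disk /open_disk /= => /ltW.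
have circle_out s w : circle w -> ~ Nbd_Sigma hP (hP (s, w)).
  move=> cw [[s' w'] [_ /= ow] /(congr1 g)].
  rewrite !gK; [|by split => //; exact: disk_circle|by split => //; exact: disk_open].
  by move=> [_ ww]; move: ow cw; rewrite /open_disk /circle /= ww => + cw; rewrite cw ltxx.
pose q (a : S * (R * R)) := (a.1, radial a.2).
pose r p := if pselect (Nbd_Sigma hP p) then hP (q (g p)) else p.
(* [r] is defined by cases on the open neighborhood, but pasting needs the radial formula on the
   closed disk bundle; on boundary circles it is the identity. *)
have rE p : (hP @` (setT `*` disk)) p -> r p = hP (q (g p)).
  move=> [[s w] [_ /= dw] <-]; rewrite /r; case: pselect => // nN.
  rewrite gK // /q /= radial_id //; rewrite /circle /=; apply/le_anti/andP.
  split; first exact: dw.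
  rewrite leNgt; apply/negP => lt1; apply: nN; exists (s, w) => //.
have g0 p : (hP @` (setT `*` disk)) p -> ~ (hP @` (setT `*` [set (0, 0)])) p ->
    (g p).2 <> (0, 0).
  move=> [[s w] [_ /= dw] <-]; rewrite gK // => h w0; apply: h.
  by exists (s, w).
exists r; split.
- apply: (@within_continuous_paste _ _ _ (hP @` (setT `*` disk)) (~` Nbd_Sigma hP)).
  (* The disk bundle is the continuous image of a compact space in a Hausdorff one. *)
  + apply: compact_closed => //; apply: continuous_compact => //.
    by apply: compact_setX => //; exact: compact_disk.
  + exact: open_closedC.
  + move=> p _; case: (pselect (Nbd_Sigma hP p)) => [[a [_ oa] ap]|]; last by right.
    by left; exists a => //; split => //; exact: disk_open.
  + apply: (@within_continuous_eq _ _ _ (hP \o (q \o g))).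
      by move=> p [_ /rE].
    refine (@within_continuous_compose _ _ _ _ (setT `*` disk) _ _ _ _ chP).
      refine (@within_continuous_compose _ _ _ _ [set a | a.2 <> (0, 0)] _ _ _ _ _).
      * by apply: continuous_subspaceW cg => p [].
      * by move=> p [np dp]; exact: g0.
      * apply/within_continuousP => a /= a0.
        have c1 : continuous (fun b : S * (R * R) => b.1) by continuity.
        have c2 : continuous (fun b : S * (R * R) => b.2) by continuity.
        have h2 := continuous_comp (c2 a) (continuous_radial a0).
        exact: (cvg_trans (cvg_app _ (cvg_within _)) (cvg_pair (c1 a) h2)).
    move=> p [np dp] /=; split => //=.
    by apply: disk_circle; apply: radial_circle; exact: g0.
  + apply: (@within_continuous_eq _ _ _ id).
      by move=> p [_ nN]; rewrite /r; case: pselect.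
    by apply: within_continuousT; exact: continuous_idfun.
- move=> p np; rewrite /r; case: pselect => // -[[s w] [_ /= ow] ep].
  rewrite -ep gK; last by split => //; exact: disk_open.
  apply: circle_out; apply: radial_circle => /= w0.
  by apply: np; exists (s, w) => //; split.
- by move=> p; rewrite /r; case: pselect.
Qed.

End RadialRetraction.

(** * Position of the removed sets in the torus *)

Section TorusRegions.
Context {R : realType}.
Variable eps : R.
Hypothesis heps : 0 < eps <= pi / 30.

Lemma cisN (a b : R) : cis (- a) = cis (- b) -> cis a = cis b.
Proof.
move=> e; have ec := cis_cos e; have es := cis_sin e.
apply: val_inj => /=; rewrite !cosN in ec; rewrite !sinN in es.
by rewrite ec (oppr_inj es).
Qed.

(** Positivity separates the push-off from the slices z = 0 and t = 0; the bound by cos eps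
    separates it from the surgery neighborhoods. Here delta < eps, and eps < pi/2 - delta. *)
Lemma sin_delta (delta : R) : 0 < delta < eps ^+ 2 / 8 ->
  0 < sin delta < cos eps.
Proof.
case/andP: heps => eps0 epspi /andP[d0 d1]; have pi2 := pi_ge2 R.
have [/andP[_ pi4] _] := pihalf_02_cos_pihalf R.
have deps : delta < eps by nra.
rewrite sin_gt0_pi; last lra.
rewrite -cosBpihalf -cosN opprB ltr_cos ?in_itv /=; lra.
Qed.

Lemma Nbd_z_subset : Nbd_z eps `<=` ~` (Nbd_x eps `|` Nbd_y eps).
Proof.
move=> w Nw; have c0 := cos_eps_gt0 heps; move: (Nw).
case: Nw => x [y [z [t [_ ->]]]] /(Nbd_zE heps)[? ?].
by case=> [/(Nbd_xE heps)|/(Nbd_yE heps)] []; lra.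
Qed.

Lemma E0_subset z t : - cos eps <= sin z <= cos eps ->
  E0 eps z t `<=` ~` (Nbd_x eps `|` Nbd_y eps).
Proof.
move=> hz w [[x [y ->]] _].
by case=> [/(Nbd_xE heps)|/(Nbd_yE heps)] []; lra.
Qed.

(** Within eps of z = pi/2 one has sin z >= cos eps > sin dz, so the push-off lies elsewhere. *)
Lemma bNbd_x_subset dz dt : sin dz < cos eps ->
  bNbd_x eps `<=` complement_region eps dz dt.
Proof.
case/andP: (heps) => eps0 epspi; have pi2 := pi_ge2 R; have c0 := cos_eps_gt0 heps.
move=> sd w [x [y [z [t [yz ->]]]]]; have zy := yz; rewrite addrC in zy.
have cy := cos_le_cos_eps heps yz; have cz := cos_le_cos_eps heps zy.
have ny : `|y| <= eps by apply: (norm_le_of_sum_sqr (b := z)); rewrite ?yz.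
have nz : `|z| <= eps by apply: (norm_le_of_sum_sqr (b := y)); rewrite ?zy.
split.
- case; first by apply: (near_x_notin_Nbd_x heps); rewrite ?yz //; lra.
  by move=> /(Nbd_yE heps)[_]; rewrite sin_pihalfD; lra.
- by move=> /(Nbd_zE heps)[_]; rewrite sinNpihalfD; lra.
- move=> [[x' [y' /cis4_inj[_ _ /cis_sin ez _]]] _].
  by move: ez; rewrite sin_pihalfD; lra.
Qed.

Lemma bpar_zE (z t th : R) :
  (~` (Nbd_x eps `|` Nbd_y eps)) (bpar_z eps z t th) /\
  ~ Nbd_z eps (bpar_z eps z t th).
Proof.
case/andP: (heps) => eps0 epspi; have pi2 := pi_ge2 R; have c0 := cos_eps_gt0 heps.
rewrite /bpar_z; set x := _ * cos _; set y := _ * sin _.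
have xy : x ^+ 2 + y ^+ 2 = eps ^+ 2.
  by rewrite /x /y !exprMn -mulrDr cos2Dsin2 mulr1.
have yx := xy; rewrite addrC in yx.
have cx := cos_le_cos_eps heps xy; have cy := cos_le_cos_eps heps yx.
have nx : `|x| <= eps by apply: (norm_le_of_sum_sqr (b := y)); rewrite ?xy.
have ny : `|y| <= eps by apply: (norm_le_of_sum_sqr (b := x)); rewrite ?yx.
split.
  case=> [/(Nbd_xE heps)[+ _]|/(Nbd_yE heps)[+ _]].
    by rewrite sin_pihalfD; lra.
  by rewrite sinNpihalfD; lra.
move=> [x' [y' [z' [t' [xy' /cis4_inj[/cis_sin ex /cis_sin ey _ _]]]]]].
have yx' := xy'; rewrite addrC in yx'.
have nx' := norm_lt_of_sum_sqr eps0 xy'; have ny' := norm_lt_of_sum_sqr eps0 yx'.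
move: ex ey; rewrite !sinNpihalfD !sin_pihalfD => /oppr_inj ex ey.
move: xy'; rewrite -(@cos_eq_sqr _ x _ _ _ ex); try lra.
by rewrite -(@cos_eq_sqr _ y _ _ _ ey) ?xy ?ltxx; lra.
Qed.

(** The shift by pi/4 in the parametrization places theta = 0 over e_z, so phi can be evaluated
    there without changing the angle. *)
Lemma bpar_z0 (z t : R) : bpar_z eps z t 0 = torus_point ((e4 eps).1.1.1, (e4 eps).1.1.2, z, t).
Proof.
have c2 := @sqr_cos_piquarter R; have c0 := @cos_piquarter_gt0 R.
have s2 : 0 < Num.sqrt 2 :> R by rewrite sqrtr_gt0.
have s22 := @sqr_sqrtr R 2 (ler0n _ _).
have cE : cos (pi / 4) = (Num.sqrt 2)^-1 :> R.
  apply: (mulIf (negbT (gt_eqF s2))); rewrite mulVf ?gt_eqF //.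
  by move: (cos _) (Num.sqrt _) c2 c0 s2 s22 => c s c2 c0 s2 s22; nra.
rewrite /bpar_z /near_z /torus_point /= sub0r cosN sinN sin_piquarter cE.
by rewrite mulrN.
Qed.

End TorusRegions.

(** * Regions clear of the removed sets *)

Lemma embedding_continuous (R : realType) (n m : nat) (M N : topologicalType)
    (AM : atlas R n M) (AN : atlas R m N) (A : set M) (f : M -> N) :
  embedding AM AN A f -> {within A, continuous f}.
Proof. by move=> [[]]. Qed.

Lemma embedding_inj (R : realType) (n m : nat) (M N : topologicalType)
    (AM : atlas R n M) (AN : atlas R m N) (A : set M) (f : M -> N) :
  embedding AM AN A f -> forall a b, A a -> A b -> f a = f b -> a = b.
Proof. by move=> [_ _ [g [_ gK]]] a b Aa Ab /(congr1 g); rewrite !gK. Qed.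

Section ClearRegions.
Context {R : realType}.
Variable eps delta : R.
Hypothesis heps : 0 < eps <= pi / 30.
Hypothesis hdelta : 0 < delta < eps ^+ 2 / 8.
Context {T : topologicalType} {AT : atlas R 4 T} {i : T4 R -> T}.
Hypothesis ei : embedding (@T4_atlas R) AT (~` (Nbd_x eps `|` Nbd_y eps)) i.

Let sd : 0 < sin delta < cos eps. Proof. exact: sin_delta. Qed.

(* The points of T4sur that P minus the push-off retains: [dz], [dt] are the
   coordinates of the push-off, [delta, delta] or [delta, - delta]. *)
Definition clear dz dt : set T :=
  [set a | ~ (i @` Nbd_z eps) a /\ ~ (i @` E0 eps dz dt) a].

Let i_inj : forall a b, (~` (Nbd_x eps `|` Nbd_y eps)) a ->
  (~` (Nbd_x eps `|` Nbd_y eps)) b -> i a = i b -> a = b.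
Proof. exact: embedding_inj ei. Qed.

Lemma E0_delta_subset dt : E0 eps delta dt `<=` ~` (Nbd_x eps `|` Nbd_y eps).
Proof.
have c0 := cos_eps_gt0 heps; apply: E0_subset => //.
by case/andP: sd => ? ?; lra.
Qed.

(** The values of [i] on the surgery neighborhoods are arbitrary, so injectivity may be used only
    off them; [Nbd_z] and [E0] at level delta are disjoint from them. *)
Lemma clear_embedding dt w : complement_region eps delta dt w ->
  clear delta dt (i w).
Proof.
move=> [Xw nz nE]; split=> -[w' Nw' e].
- by apply: nz; rewrite -(i_inj (Nbd_z_subset heps Nw') Xw e).
- by apply: nE; rewrite -(i_inj (E0_delta_subset Nw') Xw e).
Qed.

Lemma clear_embedding_continuous dt :
  {within complement_region eps delta dt, continuous i}.
Proof. by apply: continuous_subspaceW (embedding_continuous ei) => w []. Qed.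

Lemma bpar_z_clear z t th : ~ (i @` Nbd_z eps) (i (bpar_z eps z t th)).
Proof.
have [Xb nb] := bpar_zE heps z t th.
by move=> [w Nw e]; apply: nb; rewrite -(i_inj (Nbd_z_subset heps Nw) Xb e).
Qed.

(** A point of the glued piece can coincide with a point from the torus only along the boundary of
    the neighborhood of T_x, which lies in the complement region. *)
Lemma surgery_clear gx gy (j : bool -> (R * R) * T2 R -> T) dt :
  surgery_maps eps gx gy ->
  glued (@T4_atlas R) (prod_atlas plane_atlas T2_atlas) AT
    (~` (Nbd_x eps `|` Nbd_y eps)) (disk `*` setT) (surgery_rel gx gy) i j ->
  forall b, (disk `*` setT) b -> clear delta dt (j true b).
Proof.
move=> [[_ gxB _] _ _ _] [_ _ _ ij _] b Db.
have bad w : (~` (Nbd_x eps `|` Nbd_y eps)) w -> i w = j true b ->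
    complement_region eps delta dt w.
  move=> Xw /(ij true w b Xw Db)[c [p [_ ->]]].
  have [_ sd2] := andP sd; apply: (bNbd_x_subset heps _ sd2).
  by rewrite -gxB; exists (c, p).
split=> -[w Nw e].
- by have [] := bad w (Nbd_z_subset heps Nw) e.
- by have [] := bad w (E0_delta_subset Nw) e.
Qed.

Context {P : topologicalType} {AP : atlas R 4 P} {k1 k2 : T -> P}.
Hypothesis hk : glued AT AT AP (~` (i @` Nbd_z eps)) (~` (i @` Nbd_z eps))
  (phi_rel eps i) k1 (fun _ => k2).

Let core := Sigma_P eps (k1 \o i) (k2 \o i) delta.

Lemma E0_notin_Nbd_z dt w : E0 eps delta dt w -> ~ (i @` Nbd_z eps) (i w).
Proof.
move=> Ew [w' Nw' /(i_inj (Nbd_z_subset heps Nw') (E0_delta_subset Ew)) e].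
by case: Ew => _; apply; rewrite -e.
Qed.

Lemma bpar_z_E0 (z t th : R) dz dt : cis z = cis dz -> cis t = cis dt ->
  E0 eps dz dt (bpar_z eps z t th).
Proof.
move=> ez et; split; last by case: (bpar_zE heps z t th).
by eexists; eexists; rewrite /bpar_z /near_z /cis4 ez et.
Qed.

(** A point of the first copy meets the second half of the push-off only through phi, and phi
    carries the level (delta, delta) to (delta, -delta); the point would then already lie on the
    first half. *)
Lemma k1_clear a : clear delta delta a -> ~ core (k1 a).
Proof.
case: hk => [[e1 e2] _ _ kk _] [az aE] [[w Ew /= e]|[w Ew /= e]].
  apply: aE; exists w => //; apply: (embedding_inj e1) e => //.
  exact: E0_notin_Nbd_z Ew.
have := kk tt a (i w) az (E0_notin_Nbd_z Ew) => -[+ _] => /(_ (esym e)).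
move=> [z [t [th [ea]]]] /(i_inj (E0_delta_subset Ew) (proj1 (bpar_zE heps _ _ _))).
case: Ew => [[x [y ->]] _] /cis4_inj[_ _ et ez].
apply: aE; exists (bpar_z eps z t th); last by rewrite ea.
by apply: bpar_z_E0; [exact/esym/cisN|].
Qed.

Lemma k2_clear a : clear delta (- delta) a -> ~ core (k2 a).
Proof.
case: hk => [[e1 e2] _ _ kk _] [az aE] [[w Ew /= e]|[w Ew /= e]]; last first.
  apply: aE; exists w => //; apply: (embedding_inj (e2 tt)) e => //.
  exact: E0_notin_Nbd_z Ew.
have := kk tt (i w) a (E0_notin_Nbd_z Ew) az => -[+ _] => /(_ e).
move=> [z [t [th [e' ea]]]]; move: e' => /(i_inj (E0_delta_subset Ew) (proj1 (bpar_zE heps _ _ _))).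
case: Ew => [[x [y ->]] _] /cis4_inj[_ _ ez et].
apply: aE; exists (bpar_z eps t (- z) (- th)); last by rewrite ea.
by apply: bpar_z_E0 => //; apply: cisN; rewrite !opprK.
Qed.
End ClearRegions.

(** * The surgery disk *)

Section SurgeryDisk.
Context {R : realType}.
Local Notation "p ~~ q" := (teq p q) (at level 70).

Lemma convex_unit_square : convex_in (@unit_square R).
Proof.
move=> a b t /unit_squareP[a1 a2] /unit_squareP[b1 b2] t01.
have step (x y : R) : 0 <= x <= 1 -> 0 <= y <= 1 -> 0 <= x + t * (y - x) <= 1.
  by move=> ? ?; apply/andP; split; nra.
by apply/unit_squareP; split; apply: step.
Qed.

Lemma unit_square_sides : [/\ path_in (@unit_square R) (fun s => (s, 0)),
  path_in (@unit_square R) (fun s => (s, 1)),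
  path_in (@unit_square R) (fun s => (0, s))
  & path_in (@unit_square R) (fun s => (1, s))].
Proof.
by split; (split; first by apply: within_continuousT; continuity);
  move=> s s01; apply/unit_squareP; rewrite /= ?lexx ?ler01.
Qed.

Lemma side_square_teq (X : topologicalType) (F : R * R -> X) (x y y' z : X)
    (p : tpath R x y) (q : tpath R y z) (p' : tpath R x y') (q' : tpath R y' z) :
  {within (@unit_square R), continuous F} ->
  (forall s, 0 <= s <= 1 -> p s = F (s, 0)) ->
  (forall s, 0 <= s <= 1 -> q s = F (1, s)) ->
  (forall s, 0 <= s <= 1 -> p' s = F (0, s)) ->
  (forall s, 0 <= s <= 1 -> q' s = F (s, 1)) ->
  tcat p q ~~ tcat p' q'.
Proof.
have [? ? ? ?] := unit_square_sides.
by move=> cF; apply: (square_teq convex_unit_square cF).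
Qed.

Variable eps delta dt : R.
Hypothesis heps : 0 < eps <= pi / 30.
Hypothesis hdelta : 0 < delta < eps ^+ 2 / 8.
Context {T : topologicalType} {AT : atlas R 4 T} {i : T4 R -> T}.
Context {gx gy : S1 R * T2 R -> T4 R} {j : bool -> (R * R) * T2 R -> T}.
Hypothesis hs : surgery_maps eps gx gy.
Hypothesis hg : glued (@T4_atlas R) (prod_atlas plane_atlas T2_atlas) AT
  (~` (Nbd_x eps `|` Nbd_y eps)) (disk `*` setT) (surgery_rel gx gy) i j.

(** The loop along a boundary circle of the glued piece is contractible there, and the given free
    homotopy carries it to [bloop_x] followed by the reversed [mu_x]. *)
Lemma surgery_homotopic (Z : topologicalType) (psi : T -> Z) :
  {within clear eps (i := i) delta dt, continuous psi} ->
  path_homotopic setT (psi \o i \o bloop_x eps) (psi \o i \o mu_x eps).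
Proof.
move=> cpsi; have [[ei ej] _ _ ij _] := hg.
have [_ sd] := andP (sin_delta heps hdelta).
have bsub := bNbd_x_subset heps dt sd.
pose F := psi \o i.
have cF : {within bNbd_x eps, continuous F}.
  refine (@within_continuous_compose _ _ _ _ _ _ _ _ _ cpsi).
    apply: continuous_subspaceW (clear_embedding_continuous ei (dt := dt)).
    exact: bsub.
  by move=> w /bsub; exact: (clear_embedding heps hdelta ei).
pose p0 : T2 R := (cis 0, cis 0).
have [[_ gxB _] _ /(_ p0)[H [cH HB H1 H2]] _] := hs.
have cFH : {within (@unit_square R), continuous (F \o H)}.
  refine (@within_continuous_compose _ _ _ _ _ _ _ cH _ cF).
  by move=> w sw; apply: HB; exists w.
have bE s : bNbd_x eps (bloop_x eps s).
  by exists (2 * pi * s), eps, 0, 0; rewrite expr0n addr0.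
have mE s : bNbd_x eps (mu_x eps s).
  exists 0, (eps * cos (2 * pi * s)), (eps * sin (2 * pi * s)), 0; split => //.
  by rewrite !exprMn -mulrDr cos2Dsin2 mulr1.
have e2 : 0 <= (1 : R) <= 1 by rewrite lexx ler01.
have e1 : 0 <= (0 : R) <= 1 by rewrite lexx ler01.
have cis2pi : cis (2 * pi * 1) = cis (2 * pi * 0) :> S1 R.
  by rewrite -[RHS]cisD2pi; congr cis; ring.
have cB : {within `[0, 1], continuous (F \o bloop_x eps)}.
  refine (@within_continuous_compose _ _ _ _ _ _ _ _ _ cF) => //.
  by apply: within_continuousT; rewrite /bloop_x /near_x /cis4; continuity.
have cM : {within `[0, 1], continuous (F \o mu_x eps)}.
  refine (@within_continuous_compose _ _ _ _ _ _ _ _ _ cF) => //.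
  by apply: within_continuousT; rewrite /mu_x /near_x /cis4; continuity.
pose m := F (bloop_x eps 0).
have B1 : (F \o bloop_x eps) 1 = m.
  by rewrite /m /= /bloop_x /near_x /cis4 cis2pi.
have M0 : (F \o mu_x eps) 0 = m.
  rewrite /m /= /bloop_x /mu_x; congr F.
  by rewrite mulr0 cos0 sin0 mulr1 mulr0.
have M1 : (F \o mu_x eps) 1 = m.
  rewrite -M0 /= /mu_x; congr F.
  by rewrite (cis_cos cis2pi) (cis_sin cis2pi).
pose B : tpath R m m := Path cB erefl B1.
pose M : tpath R m m := Path cM M0 M1.
have [_ _ side0 _] := unit_square_sides.
have H01 : (F \o H) (0, 1) = m by rewrite /= (proj2 (H1 0 e1)) path_cat0.
(* [D] is the track of the base point during the free homotopy; [G] is conjugated along it. *)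
pose D : tpath R (F (H (0, 0))) m := image_path cFH side0 erefl H01.
have [side1 _ _ _] := unit_square_sides.
have H10 : (F \o H) (1, 0) = F (H (0, 0)) by rewrite /= (H2 0 e1).
pose G : tpath R (F (H (0, 0))) (F (H (0, 0))) :=
  image_path cFH side1 erefl H10.
have GD : tcat G D ~~ tcat D (tcat B (tinv M)).
  apply: (side_square_teq cFH) => // s s01 /=.
    by rewrite (H2 s s01).
  by rewrite (proj2 (H1 s s01)) /path_cat; case: ifP.
(* The disk in polar coordinates, [w.1] for the angle and [w.2] for the radius. The side of radius 0
   is constant and both radial sides are [La], so [G] is trivial. *)
pose K (w : R * R) := psi (j true ((w.2 * cos (2 * pi * w.1),
  w.2 * sin (2 * pi * w.1)), p0)).
have cK : {within (@unit_square R), continuous K}.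
  refine (@within_continuous_compose _ _ _ _ (disk `*` setT)
    (fun w : R * R => ((w.2 * cos (2 * pi * w.1),
    w.2 * sin (2 * pi * w.1)), p0)) (psi \o j true) _ _ _).
  - by apply: within_continuousT; continuity.
  - move=> w /unit_squareP[w1 w2]; split => //=.
    rewrite /disk /= !exprMn -mulrDr cos2Dsin2 mulr1; nra.
  - refine (@within_continuous_compose _ _ _ _ _ _ _
      (embedding_continuous (ej true)) _ cpsi).
    by move=> b Db; apply: (surgery_clear heps hdelta dt hs hg).
have FgK c : F (gx (c, p0)) = psi (j true (val c, p0)).
  have bg : bNbd_x eps (gx (c, p0)) by rewrite -gxB; exists (c, p0).
  congr psi; apply/ij.
  - by have [] := bsub _ bg.
  - by split => //=; rewrite /disk /=; have /set_mem := valP c; rewrite /circle /= => ->.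
  - by exists c, p0.
have side00 : K (0, 1) = F (H (0, 0)).
  rewrite (proj1 (H1 0 e1)) FgK /K /= mulr0 cos0 sin0 !mul1r.
  by [].
pose La : tpath R (K (0, 0)) (F (H (0, 0))) := image_path cK side0 erefl side00.
have LaG : tcat (tid (K (0, 0))) La ~~ tcat La G.
  apply: (side_square_teq cK) => // s s01 /=.
  - by rewrite /K /= !mul0r.
  - by rewrite /K /= (cis_cos cis2pi) (cis_sin cis2pi).
  - by rewrite (proj1 (H1 s s01)) FgK /K /= !mul1r.
have G1 : G ~~ tid _.
  by apply: (tcat_injl (r := La)); rewrite -LaG teq_idl teq_idr.
have BM : tcat B (tinv M) ~~ tid _.
  by apply: (tcat_injl (r := D)); rewrite -GD G1 teq_idl teq_idr.
have : B ~~ M.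
  by apply: (tcat_injr (r := tinv M)); rewrite BM teq_invr.
by [].
Qed.

End SurgeryDisk.

(** * The relations in Z *)

Section BasedLoops.
Context {R : realType}.
Variable eps : R.
Hypothesis heps : 0 < eps <= pi / 30.

Lemma rho1_E0 (s : R) : 0 <= s <= 1 -> E0 eps 0 0 (rho1 eps s).
Proof.
move=> s01; have pi2 := pi_ge2 R; have [eps0 epspi] := andP heps.
have /andP[h0 h1] : 0 < eps / Num.sqrt 2 <= eps := eps_div_sqrt2 heps.
split; first by do 2 eexists.
apply: (rectangle_notin_Nbd_z heps).
  by move: (eps / _) h0 h1 => eta h0 h1; nra.
by move: (eps / _) h0 h1 => eta h0 h1; nra.
Qed.

Lemma loop_x_E0 s : E0 eps 0 0 (loop_x s).
Proof.
split; first by do 2 eexists.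
by move=> /(Nbd_zE heps)[_]; have := cos_eps_gt0 heps; rewrite sin0; lra.
Qed.

Lemma loop_y_E0 s : E0 eps 0 0 (loop_y s).
Proof.
split; first by do 2 eexists.
by move=> /(Nbd_zE heps)[+ _]; have := cos_eps_gt0 heps; rewrite sin0; lra.
Qed.

(** This keeps the based loops on Sigma_P, where the retraction is the identity. *)
Lemma based_E0 (l : R -> T4 R) s : (forall s, E0 eps 0 0 (l s)) ->
  0 <= s <= 1 -> E0 eps 0 0 (based eps l s).
Proof.
move=> lE s01; rewrite /based /path_cat /path_rev.
case: ifPn => h1; first by apply: rho1_E0; lra.
by case: ifPn => h2; [exact: lE|apply: rho1_E0; lra].
Qed.

Lemma based0 (l : R -> T4 R) : based eps l 0 = e_z eps.
Proof. by rewrite /based path_cat0 path_rev0. Qed.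

Lemma based1 (l : R -> T4 R) : based eps l 1 = e_z eps.
Proof. by rewrite /based !path_cat1. Qed.

End BasedLoops.

Section TypedLoops.
Context {R : realType} {X : topologicalType}.

Lemma path_rev_continuousK (f : R -> X) :
  {within `[0, 1], continuous (path_rev f)} -> {within `[0, 1], continuous f}.
Proof.
move=> /path_rev_continuous; apply: within_continuous_eq => s _.
by rewrite /path_rev subKr.
Qed.

Lemma tpath_exists (f : R -> X) (x y : X) : {within `[0, 1], continuous f} ->
  f 0 = x -> f 1 = y -> exists p : tpath R x y, path_fun p = f.
Proof. by move=> cf f0 f1; exists (Path cf f0 f1). Qed.

Lemma pi1_trivialP (x : X) (p : tpath R x x) :
  teq p (tid x) <-> pi1_trivial (path_fun p).
Proof. by rewrite /pi1_trivial path0. Qed.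

End TypedLoops.

Section CommutatorAlgebra.
Context {R : realType} {X : topologicalType}.
Local Notation "p ~~ q" := (teq p q) (at level 70).

(** The hypotheses carry inverses because the gluings deliver them so: Psi produces the inverse of
    y', and t'' is the inverse of z'. *)
Lemma commutator_algebra (e : X) (x y z u v : tpath R e e) :
  let g := tcat v (tcat (tinv u) (tinv v)) in
  intertwines g (tinv y) (tinv y) ->
  x ~~ tcat z (tcat (tinv y) (tcat (tinv z) y)) ->
  intertwines u (tinv z) (tinv z) -> intertwines v (tinv z) (tinv z) ->
  intertwines g (tcat y (tcat (tinv x) (tinv y)))
    (tcat y (tcat (tinv x) (tinv y))).
Proof.
move=> g gy xE uz vz.
have yg : intertwines y g g.
  by rewrite /intertwines -(tinvK y); apply/intertwines_tinv/intertwines_sym.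
have zg : intertwines z g g.
  rewrite /intertwines -(tinvK z); apply/intertwines_tinv/intertwines_sym.
  apply: (intertwines_tcat vz); apply: intertwines_tcat.
    exact: (intertwines_tinv uz).
  exact: (intertwines_tinv vz).
have xg : intertwines x g g.
  rewrite /intertwines xE; apply: (intertwines_tcat zg).
  apply: (intertwines_tcat (intertwines_tinv yg)).
  exact: intertwines_tcat (intertwines_tinv zg) yg.
apply: intertwines_sym; apply: (intertwines_tcat yg).
exact: intertwines_tcat (intertwines_tinv xg) (intertwines_tinv yg).
Qed.

End CommutatorAlgebra.

Theorem theorem9p1 (R : realType) (eps delta : R)
  (heps : 0 < eps <= pi / 30) (hdelta : 0 < delta < eps ^+ 2 / 8)
  (T : topologicalType) (AT : atlas R 4 T) (i : T4 R -> T)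
  (hT : is_T4sur eps AT i)
  (P : topologicalType) (AP : atlas R 4 P) (k1 k2 : T -> P)
  (hk : is_P eps AT i AP k1 k2)
  (S : topologicalType) (AS : atlas R 2 S) (q : R * R -> S)
  (hS : is_genus2 AS q)
  (hP : S * (R * R) -> P)
  (hhP : is_hP AS q eps delta AP (k1 \o i) (k2 \o i) hP)
  (Psi : S -> S) (hPsi : is_Psi AS q Psi)
  (W : topologicalType) (AW : atlas R 4 W) (mW : manifold_with_boundary AW)
  (hW : S * S1 R -> W)
  (hhW : diffeo (prod_atlas AS circle_atlas) AW setT (boundary AW) hW)
  (hcomm : pi1_trivial
     (path_comm (fun s : R => hW (gen_b1 q s, cis 0))
            (fun s : R => hW (gen_a2 q s, cis 0))))
  (Z : topologicalType) (AZ : atlas R 4 Z) (jW : W -> Z) (jP : P -> Z)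
  (hZ : is_Z AW hW Psi AP hP AZ jW jP) :
  let y1 : R -> Z := jP \o k1 \o i \o based eps loop_y in
  let x1 : R -> Z := jP \o k1 \o i \o based eps loop_x in
  let y2 : R -> Z := jP \o k2 \o i \o based eps loop_y in
  let x2 : R -> Z := jP \o k2 \o i \o based eps loop_x in
  pi1_trivial
    (path_comm (fun s : R => jW (hW (gen_a1 q s, cis 0)))
           (fun s : R => jW (hW (gen_a2 q s, cis 0)))) /\
  pi1_trivial
    (path_comm (path_cat y1 (path_cat (path_rev x1) (path_rev y1)))
           (path_cat y2 (path_cat (path_rev x2) (path_rev y2)))).
Proof.
move=> y1 x1 y2 x2.
have [_ _ _ [gx [gy [j [hs hg]]]]] := hT.
have [[ei _] _ _ _ _] := hg.
have [[mP _] _ _ _ hgk] := hk.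
have [[ek1 ek2] _ _ kk _] := hgk.
have {}ek2 := ek2 tt.
have [hausP _ _ _ _] := mP.
have [[[_ cptS] _] _ _ _ _] := hS.
have [[eP _ oN] hcore hSP _ [pa1 pb1 pa2 pb2]] := hhP.
have [[cP _] _ [g [[cg _] gK]]] := eP.
have [r [cr rout rid]] := radial_retraction cptS hausP cP cg gK oN.
have [_ [[ejW ejP] _ _ ww _]] := hZ.
have {}ejP := ejP tt.
have [sd0 sd1] := andP (sin_delta heps hdelta).
have disk1 : @disk R (1, 0) by rewrite /disk /= expr0n addr0 expr1n.
have out1 s : ~ Nbd_Sigma hP (hP (s, (1, 0))).
  move=> [[s' w'] [_ /= ow] e].
  have dw' : (setT `*` @disk R) (s', w') by split => //=; exact: ltW.
  have [_ ew] := embedding_inj eP dw' (conj I disk1 : (setT `*` @disk R) (s, _)) e.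
  by move: ow; rewrite /open_disk /= ew /= expr0n addr0 expr1n ltxx.
have SPout p : Sigma_P eps (k1 \o i) (k2 \o i) 0 p -> ~ Nbd_Sigma hP p.
  by rewrite -hSP => -[[s w] [_ /= ->] <-]; exact: out1.
have cjr : {within ~` Sigma_P eps (k1 \o i) (k2 \o i) delta, continuous (jP \o r)}.
  rewrite hcore in cr rout.
  by refine (@within_continuous_compose _ _ _ _ _ _ _ cr rout _);
    exact: embedding_continuous ejP.
(* The inclusions are corrected by the retraction: [jP] is continuous only off the open
   neighborhood, while [jP \o r] is continuous off its core. *)
pose psi1 := jP \o r \o k1; pose psi2 := jP \o r \o k2.
have cpsi1 : {within clear eps (i := i) delta delta, continuous psi1}.
  refine (@within_continuous_compose _ _ _ _ _ _ _ _ _ cjr).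
    by apply: continuous_subspaceW (embedding_continuous ek1) => a [].
  by move=> a; exact: (k1_clear heps hdelta ei hgk).
have cpsi2 : {within clear eps (i := i) delta (- delta), continuous psi2}.
  refine (@within_continuous_compose _ _ _ _ _ _ _ _ _ cjr).
    by apply: continuous_subspaceW (embedding_continuous ek2) => a [].
  by move=> a; exact: (k2_clear heps hdelta ei hgk).
pose F1 := psi1 \o i; pose F2 := psi2 \o i.
have cF1 : {within complement_region eps delta delta, continuous F1}.
  refine (@within_continuous_compose _ _ _ _ _ _ _
    (clear_embedding_continuous ei (dt := delta)) _ cpsi1).
  by move=> w; exact: (clear_embedding heps hdelta ei).
have cF2 : {within complement_region eps delta (- delta), continuous F2}.
  refine (@within_continuous_compose _ _ _ _ _ _ _
    (clear_embedding_continuous ei (dt := - delta)) _ cpsi2).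
  by move=> w; exact: (clear_embedding heps hdelta ei).
(* At level (0, 0) the correction is invisible, so the corrected maps still compute the loops of the
   statement. *)
have F1E w : E0 eps 0 0 w -> F1 w = jP (k1 (i w)).
  by move=> Ew; rewrite /F1 /= /psi1 /= rid //; apply: SPout; left; exists w.
have F2E w : E0 eps 0 0 w -> F2 w = jP (k2 (i w)).
  move=> Ew; rewrite /F2 /= /psi2 /= rid //; apply: SPout; right; exists w => //.
  by rewrite oppr0.
have k12 z t : k1 (i (bpar_z eps z t 0)) = k2 (i (bpar_z eps t (- z) 0)).
  apply/(kk tt); [exact: (bpar_z_clear heps ei)|exact: (bpar_z_clear heps ei)|].
  by exists z, t, 0; rewrite oppr0.
pose chi s := jP (hP (s, (1, 0))).
have cchi : {within setT, continuous chi}.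
  refine (@within_continuous_compose _ _ _ _ (~` Nbd_Sigma hP)
    (fun s => hP (s, (1, 0))) jP _ _ (embedding_continuous ejP)); last by
    move=> s _; exact: out1.
  refine (@within_continuous_compose _ _ _ _ (setT `*` disk)
    (fun s => (s, (1, 0))) hP _ _ cP); last by move=> s _; split.
  by apply: within_continuousT; continuity.
have cjSP : {within Sigma_P eps (k1 \o i) (k2 \o i) 0, continuous jP}.
  by apply: continuous_subspaceW (embedding_continuous ejP) => p; exact: SPout.
(* The point 1 of the circle is fixed by -Id, so over it the gluing is Psi alone. *)
have jWchi s : jW (hW (s, cis 0)) = chi (Psi s).
  apply/(ww tt) => //; first exact: out1.
  by exists s, (cis 0); rewrite /= cos0 sin0 oppr0.
have ha1 := path_homotopic_map cjSP pa1.
have hb1 := path_homotopic_map cjSP pb1.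
have ha2 := path_homotopic_map cjSP pa2.
have hb2 := path_homotopic_map cjSP pb2.
pose z0 := y1 0.
have z01 : jP (k1 (i (e_z eps))) = z0 by rewrite /z0 /y1 /= based0.
(* phi fixes (z, t, theta) = (0, 0, 0), which identifies the two base points. *)
have z02 : jP (k2 (i (e_z eps))) = z0.
  by rewrite -z01 e_zE -!bpar_z0 k12 oppr0.
have based_ends (l : R -> T4 R) (f : T4 R -> Z) : f (e_z eps) = z0 ->
    (f \o based eps l) 0 = z0 /\ (f \o based eps l) 1 = z0.
  by rewrite /= based0 based1.
have [y10 y11] := based_ends (@loop_y R) (jP \o k1 \o i) z01.
have [x10 x11] := based_ends (@loop_x R) (jP \o k1 \o i) z01.
have [y20 y21] := based_ends (@loop_y R) (jP \o k2 \o i) z02.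
have [x20 x21] := based_ends (@loop_x R) (jP \o k2 \o i) z02.
have [Y1 Y1E] := tpath_exists
  (path_homotopic_continuous (path_homotopic_sym ha1)) y10 y11.
have [X1 X1E] := tpath_exists (path_rev_continuousK
  (path_homotopic_continuous (path_homotopic_sym hb1))) x10 x11.
have [Y2 Y2E] := tpath_exists
  (path_homotopic_continuous (path_homotopic_sym ha2)) y20 y21.
have [X2 X2E] := tpath_exists (path_rev_continuousK
  (path_homotopic_continuous (path_homotopic_sym hb2))) x20 x21.
have typed (f h : R -> Z) (p : tpath R z0 z0) : path_homotopic setT f h ->
    path_fun p = h -> exists2 p' : tpath R z0 z0, path_fun p' = f & teq p' p.
  move=> fh ph; have f0 := path_homotopic_start fh; have f1 := path_homotopic_end fh.
  rewrite -ph ?path0 ?path1 in f0 f1 fh.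
  have [p' p'E] := tpath_exists (path_homotopic_continuous fh) f0 f1.
  by exists p' => //; rewrite /teq p'E.
have [a1 a1E a1Y] := typed _ _ Y1 ha1 Y1E.
have [a2 a2E a2Y] := typed _ _ Y2 ha2 Y2E.
have [b1 b1E b1X] := typed _ _ (tinv X1) hb1 ltac:(by rewrite /= X1E).
have [b2 b2E b2X] := typed _ _ (tinv X2) hb2 ltac:(by rewrite /= X2E).
have [_ _ [Pa1 Pb1] [Pa2 Pb2]] := hPsi.
have conj_loop (f h : R -> S) (p p' : tpath R z0 z0) :
    path_homotopic setT (Psi \o f) (path_cat f (path_cat h (path_rev f))) ->
    path_fun p = chi \o f -> path_fun p' = chi \o h ->
    exists2 p'' : tpath R z0 z0, path_fun p'' = chi \o (Psi \o f)
      & teq p'' (tcat p (tcat p' (tinv p))).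
  move=> /(path_homotopic_map cchi) fh pE p'E; apply: typed fh _.
  apply/funext => s; rewrite /= pE p'E /path_cat /=.
  by case: ifP => // _; case: ifP.
have rev_loop (f h : R -> S) (p : tpath R z0 z0) :
    path_homotopic setT (Psi \o h) (path_rev f) -> path_fun p = chi \o f ->
    exists2 p' : tpath R z0 z0, path_fun p' = chi \o (Psi \o h) & teq p' (tinv p).
  move=> /(path_homotopic_map cchi) fh pE; apply: typed fh _.
  by rewrite /= pE.
have [A1 A1E A1g] := conj_loop _ _ a1 b1 Pa1 a1E b1E.
have [A2 A2E A2g] := conj_loop _ _ a2 b2 Pa2 a2E b2E.
have [B1 B1E B1g] := rev_loop _ _ a1 Pb1 a1E.
pose w1 := tcat Y1 (tcat (tinv X1) (tinv Y1)).
pose w2 := tcat Y2 (tcat (tinv X2) (tinv Y2)).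
have {}A1g : teq A1 w1 by rewrite A1g a1Y b1X.
have {}A2g : teq A2 w2 by rewrite A2g a2Y b2X.
have {}B1g : teq B1 (tinv Y1) by rewrite B1g a1Y.
have w2Y1 : intertwines w2 (tinv Y1) (tinv Y1).
  (* This is the image in Z of the relation assumed in W, read on the other side of the gluing. *)
  have : intertwines A2 B1 B1.
    apply/commutator_trivialP/pi1_trivialP.
    have cjW : {within setT, continuous jW} by exact: embedding_continuous ejW.
    apply: path_homotopic_ext (path_homotopic_map cjW hcomm) => s _ /=.
      rewrite B1E A2E /path_comm /path_cat /path_rev /=.
      by do 3 (case: ifP => _; rewrite ?jWchi //).
    by rewrite B1E A2E /path_comm !path_cat0 jWchi.
  by rewrite /intertwines A2g B1g.
have sdm : 0 < sin delta by [].
have cR := rectangle_continuous heps cF1 sdm.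
pose eZ : R * R * R * R := ((e4 eps).1.1.1, (e4 eps).1.1.2, 2 * pi, 0).
have [bE bZ] : box ((e4 eps).1.1.1, 0, 0, 0) (0, (e4 eps).1.1.2, 2 * pi, 0) (e4 eps) /\
    box ((e4 eps).1.1.1, 0, 0, 0) (0, (e4 eps).1.1.2, 2 * pi, 0) eZ.
  have := eps_div_sqrt2 heps; have pi2 := pi_ge2 R; have [eps0 epspi] := andP heps.
  by rewrite /eZ /e4 /=; move: (eps / _) => eta ?; split; split => /=; lra.
have E0e : E0 eps 0 0 (e_z eps) by apply: (rho1_E0 heps); rewrite lexx ler01.
have F1e : F1 (torus_point (e4 eps)) = z0 by rewrite -e_zE F1E.
have F1Z : F1 (torus_point eZ) = z0 by rewrite -F1e; congr F1; torus_eq.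
have [Zl ZlE] := seg_path_exists cR bE bZ F1e F1Z.
have F12 z t : F1 (torus_point ((e4 eps).1.1.1, (e4 eps).1.1.2, z, t)) =
    F2 (torus_point ((e4 eps).1.1.1, (e4 eps).1.1.2, t, - z)).
  by rewrite /F1 /F2 /psi1 /psi2 /= -!bpar_z0 k12.
have surg := surgery_homotopic heps hdelta hs hg cpsi1.
have Xw : teq X1 (tcat Zl (tcat (tinv Y1) (tcat (tinv Zl) Y1))).
  apply: (x_loop_word heps cF1 sdm _ _ ZlE surg) => s s01.
    by rewrite X1E F1E //; apply: based_E0 => // s'; exact: loop_x_E0.
  by rewrite Y1E F1E //; apply: based_E0 => // s'; exact: loop_y_E0.
have [XT YT] : intertwines X2 (tinv Zl) (tinv Zl) /\
    intertwines Y2 (tinv Zl) (tinv Zl).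
  apply: (t_loop_commutes heps cF2 sdm) => s s01.
  - by rewrite X2E F2E //; apply: based_E0 => // s'; exact: loop_x_E0.
  - by rewrite Y2E F2E //; apply: based_E0 => // s'; exact: loop_y_E0.
  (* The reversed loop has (z', t') = (2 pi (1 - s), 0); phi turns this into (0, -2 pi (1 - s)),
     which is (0, 2 pi s) modulo 2 pi, the loop t''. *)
  - rewrite /= /path_rev ZlE /=; last by lra.
    rewrite (_ : torus_point (seg _ _ (1 - s)) = torus_point ((e4 eps).1.1.1,
      (e4 eps).1.1.2, 2 * pi * (1 - s), 0)); last by torus_eq.
    by rewrite F12; congr F2; torus_eq.
have comm : intertwines w2 w1 w1 := commutator_algebra w2Y1 Xw XT YT.
split.
  have : pi1_trivial (tcat A1 (tcat A2 (tcat (tinv A1) (tinv A2)))).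
    apply/pi1_trivialP/commutator_trivialP.
    by rewrite /intertwines A1g A2g.
  rewrite /= A1E A2E /pi1_trivial => h.
  apply: path_homotopic_ext h => s _.
    rewrite /path_comm /path_cat /path_rev /=.
    by do 3 (case: ifP => _; rewrite ?jWchi //).
  by rewrite /path_comm !path_cat0 /= jWchi.
have : pi1_trivial (tcat w1 (tcat w2 (tcat (tinv w1) (tinv w2)))).
  exact/pi1_trivialP/commutator_trivialP.
by rewrite /= Y1E X1E Y2E X2E.
Qed.
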